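(* Let $p$ be an odd prime and let $V$ be an elementary abelian $p$-group of rank $n$. Then the essential ideal $\operatorname{Ess}(V)$ is the Steenrod closure of $\Lambda^n(V^* )$. That is, $\operatorname{Ess}(V)$ is the smallest ideal in $H^*(V,\mathbb{F}_p)$ which contains the one-dimensional space $\Lambda^n(V^* ) \subseteq H^n(V,\mathbb{F}_p)$ and is closed under the action of the mod-$p$ Steenrod algebra.
   Context: For a finite group $G$, a class in $H^m(G,\mathbb{F}_p)$ is called essential if its restriction to every proper subgroup of $G$ is zero. The essential classes form an ideal $\operatorname{Ess}(G)$ of $H^*(G,\mathbb{F}_p)$, called the essential ideal. For $p$ odd and $V$ elementary abelian of rank $n$, regard $V$ as an $n$-dimensional $\mathbb{F}_p$-vector space with dual $V^*$. Then $H^*(V,\mathbb{F}_p) \cong S(V^* ) \otimes_{\mathbb{F}_p} \Lambda(V^* )$ as graded-commutative algebras. Here the exterior copy of $V^*$ is $H^1(V,\mathbb{F}_p)=\operatorname{Hom}(V,\mathbb{F}_p)$, and the polynomial copy of $V^*$ lies in $H^2(V,\mathbb{F}_p)$ and is the image of the exterior copy under the Bockstein $\beta$. If $a_1,\dots,a_n$ is a basis of $H^1(V,\mathbb{F}_p)$ and $x_i=\beta(a_i)$, then $H^*(V,\mathbb{F}_p) \cong \mathbb{F}_p[x_1,\dots,x_n]\otimes\Lambda(a_1,\dots,a_n)$, and $\Lambda^n(V^* )$ is spanned by $a_1a_2\cdots a_n$. The mod-$p$ Steenrod algebra is generated by the Bockstein $\beta$ and the reduced power operations $\mathcal{P}^m$,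 $m \ge 0$. Its action on $H^*(V,\mathbb{F}_p)$ is unstable and is determined by $\beta(a_i)=x_i$, $\beta(x_i)=0$, $\mathcal{P}^0=\mathrm{id}$, $\mathcal{P}^m(a_i)=0$ for $m>0$, $\mathcal{P}^1(x_i)=x_i^p$, $\mathcal{P}^m(x_i)=0$ for $m>1$, the Cartan formula for $\mathcal{P}^m$, and the graded derivation property of $\beta$. *)

(* Defs.v *)
From HB Require Import structures.
From mathcomp Require Import all_boot all_order all_algebra.
From mathcomp Require Import all_fingroup all_solvable.
From mathcomp Require Import generic_quotient ring_quotient.
From mathcomp Require Import boolp classical_sets functions.

Set Implicit Arguments.
Unset Strict Implicit.
Unset Printing Implicit Defensive.

Import Order.TTheory GRing.Theory Num.Theory.
Local Open Scope ring_scope.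
Local Open Scope quotient_scope.

(* The cochain complex [C^*(G, R)] is the direct sum over [m] of the spaces   *)
(* of inhomogeneous cochains [G^m -> R]: an element is a function on words    *)
(* over [G] that vanishes on all long enough words, and its component of      *)
(* degree [m] is its restriction to the words of length [m].                  *)

Section Cochains.
Variables (R : comNzRingType) (G : finGroupType).
Implicit Types (f g h : seq G -> R) (w : seq G).

Definition bounded : {pred seq G -> R} := fun f =>
  `[< exists N, forall w, (N < size w)%N -> f w = 0 >].

Lemma bounded_zmod_closed : zmod_closed bounded.
Proof.
split=> [|f g /asboolP[M fM] /asboolP[N gN]]; apply/asboolP; first by exists 0%N.
exists (maxn M N) => w; rewrite gtn_max => /andP[Mw Nw].
by rewrite -[LHS]/(f w - g w) fM // gN // subr0.
Qed.
HB.instance Definition _ :=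
  GRing.isZmodClosed.Build (seq G -> R) bounded bounded_zmod_closed.

Record cochain :=
  Cochain { cochain_val :> seq G -> R; cochainP : bounded cochain_val }.
HB.instance Definition _ := [isSub for cochain_val].
HB.instance Definition _ := [Choice of cochain by <:].
HB.instance Definition _ := [SubChoice_isSubZmodule of cochain by <:].

Implicit Types c : cochain.

Lemma cochain_eq c1 c2 : (forall w, c1 w = c2 w) -> c1 = c2.
Proof. by move=> e; apply/val_inj/funext. Qed.

Lemma cochain_bounded c : exists N, forall w, (N < size w)%N -> c w = 0.
Proof. exact/asboolP/(cochainP c). Qed.

Lemma cochainDE c1 c2 w : (c1 + c2) w = c1 w + c2 w. Proof. by []. Qed.
Lemma cochainNE c w : (- c) w = - c w. Proof. by []. Qed.
Lemma cochain0E w : (0 : cochain) w = 0. Proof. by []. Qed.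
Lemma cochainBE c1 c2 w : (c1 - c2) w = c1 w - c2 w. Proof. by []. Qed.

Definition homogeneous (m : nat) c := forall w, size w != m -> c w = 0.

(* Cup product: (f g)(x_1..x_(m+n)) = f(x_1..x_m) g(x_(m+1)..x_(m+n)). *)
Definition cup f g w : R :=
  \sum_(k < (size w).+1) f (take k w) * g (drop k w).

Definition cup_unit w : R := (w == [::])%:R.

Lemma cup_nil f g : cup f g [::] = f [::] * g [::].
Proof. by rewrite /cup big_ord_recl big_ord0 addr0. Qed.

Lemma cup_cons f g x w :
  cup f g (x :: w) = f [::] * g (x :: w) + cup (fun v => f (x :: v)) g w.
Proof. by rewrite /cup big_ord_recl. Qed.

Lemma cupDl f g h w : cup (fun v => f v + g v) h w = cup f h w + cup g h w.
Proof. by rewrite -big_split; apply: eq_bigr => k _; rewrite mulrDl. Qed.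

Lemma cupDr f g h w : cup f (fun v => g v + h v) w = cup f g w + cup f h w.
Proof. by rewrite -big_split; apply: eq_bigr => k _; rewrite mulrDr. Qed.

Lemma cupZl a f g w : cup (fun v => a * f v) g w = a * cup f g w.
Proof. by rewrite /cup mulr_sumr; apply: eq_bigr => k _; rewrite mulrA. Qed.

Lemma cup1l f w : cup cup_unit f w = f w.
Proof.
case: w => [|x w]; first by rewrite cup_nil mul1r.
rewrite cup_cons mul1r /cup big1 ?addr0 // => k _.
by rewrite /cup_unit mul0r.
Qed.

Lemma cup1r f w : cup f cup_unit w = f w.
Proof.
elim: w f => [|x w IHw] f; first by rewrite cup_nil mulr1.
by rewrite cup_cons /cup_unit mulr0 add0r IHw.
Qed.

Lemma cupA f g h w : cup f (cup g h) w = cup (cup f g) h w.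
Proof.
elim: w f g => [|x w IHw] f g; first by rewrite !cup_nil mulrA.
rewrite [LHS]cup_cons [RHS]cup_cons IHw.
under [X in _ = _ + X]eq_bigr do rewrite cup_cons.
rewrite [X in _ = _ + X](_ : _ =
  cup (fun v => f [::] * g (x :: v) + cup (fun u => f (x :: u)) g v) h w) //.
by rewrite cupDl cupZl cup_cons cup_nil mulrDr !mulrA addrA.
Qed.

Lemma bounded_cup c1 c2 : bounded (cup c1 c2).
Proof.
have [M cM] := cochain_bounded c1; have [N cN] := cochain_bounded c2.
apply/asboolP; exists (M + N)%N => w MNw; apply: big1 => k _.
have [Mk|kM] := ltnP M k; first by rewrite cM ?mul0r // size_takel // -ltnS.
rewrite cN ?mulr0 // size_drop ltn_subRL (leq_ltn_trans _ MNw) //.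
by rewrite leq_add2r.
Qed.

Lemma bounded_unit : bounded cup_unit.
Proof. by apply/asboolP; exists 0%N => -[]. Qed.

Definition cochain_mul c1 c2 := Cochain (bounded_cup c1 c2).
Definition cochain_one := Cochain bounded_unit.

Fact cochain_mulA : associative cochain_mul.
Proof. by move=> c1 c2 c3; apply: cochain_eq => w; apply: cupA. Qed.
Fact cochain_mul1 : left_id cochain_one cochain_mul.
Proof. by move=> c; apply: cochain_eq => w; apply: cup1l. Qed.
Fact cochain_1mul : right_id cochain_one cochain_mul.
Proof. by move=> c; apply: cochain_eq => w; apply: cup1r. Qed.
Fact cochain_mulDl : left_distributive cochain_mul +%R.
Proof. by move=> c1 c2 c3; apply: cochain_eq => w; apply: cupDl. Qed.
Fact cochain_mulDr : right_distributive cochain_mul +%R.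
Proof. by move=> c1 c2 c3; apply: cochain_eq => w; apply: cupDr. Qed.
HB.instance Definition _ := GRing.Zmodule_isPzRing.Build cochain
  cochain_mulA cochain_mul1 cochain_1mul cochain_mulDl cochain_mulDr.

(* [face i] drops the first letter if [i = 0], the last one if [i = size w],  *)
(* and otherwise multiplies the [i]-th and [i+1]-st letters.                  *)
Fixpoint face i w : seq G :=
  match i, w with
  | 0, _ :: v => v
  | 1, x :: y :: v => (x * y)%g :: v
  | i'.+1, x :: ((_ :: _) as v) => x :: face i' v
  | _, _ => [::]
  end.

Arguments face : simpl never.

Lemma face0 x w : face 0 (x :: w) = w. Proof. by []. Qed.
Lemma face1 x y w : face 1 (x :: y :: w) = (x * y)%g :: w. Proof. by []. Qed.
Lemma faceS i x y w : face i.+2 (x :: y :: w) = x :: face i.+1 (y :: w).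
Proof. by []. Qed.
Lemma face_last x : face 1 [:: x] = [::]. Proof. by []. Qed.

Lemma size_face i w : (i <= size w)%N -> size (face i w) = (size w).-1.
Proof.
elim: w i => [|x w IHw] [|i] //; case: w IHw => [|y w] IHw; case: i => [|i] //.
by rewrite ltnS => le_iw; rewrite faceS [LHS]/= IHw.
Qed.

Lemma face_face i j w : (j < i)%N -> (i <= size w)%N ->
  face j (face i w) = face i.-1 (face j w).
Proof.
elim: w i j => [|x w IHw] [|i] [|j] //; rewrite ltnS => lt_ji le_iw.
  case: w {IHw} le_iw => [|y w]; first by case: i {lt_ji}.
  by case: i {lt_ji} => [|i] le_iw.
case: i lt_ji le_iw => [|i] // lt_ji; case: w IHw => [|y w] // IHw le_iw.
rewrite faceS [i.+2.-1]/=; case: j lt_ji => [|j] lt_ji.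
  case: w le_iw {IHw} => [|z w]; first by case: i {lt_ji}.
  by case: i {lt_ji} => [|i] le_iw; rewrite ?faceS ?face1 ?mulgA.
rewrite faceS; have := IHw i.+1 j.+1 lt_ji le_iw.
case: w le_iw {IHw} => [|z w]; first by case: i lt_ji => [|i] //.
case: i lt_ji => [|i] // lt_ji le_iw; rewrite faceS /=; case: j lt_ji => [|j] lt_ji E.
  by rewrite faceS E.
by rewrite !faceS E.
Qed.

Lemma take_face_lt k i w : (k < i)%N -> (i <= size w)%N ->
  take k (face i w) = take k w.
Proof.
elim: w k i => [|x w IHw] [|k] [|i] //; first by rewrite !take0.
case: w i IHw => [|y w] [|i] // IHw lt_ki le_iw.
by rewrite faceS [LHS]/= IHw.
Qed.

Lemma drop_face_lt k i w : (k < i)%N -> (i <= size w)%N ->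
  drop k (face i w) = face (i - k) (drop k w).
Proof.
elim: w k i => [|x w IHw] [|k] [|i] //; first by rewrite !drop0.
case: w i IHw => [|y w] [|i] // IHw lt_ki le_iw.
by rewrite faceS [LHS]/= IHw.
Qed.

Lemma take_face_ge k i w : (i <= k)%N -> (k < size w)%N ->
  take k (face i w) = face i (take k.+1 w).
Proof.
elim: w k i => [|x w IHw] k [|i] //.
case: w IHw => [|y w] IHw //; case: k => [|k] // le_ik lt_kw.
case: i le_ik => [|i] le_ik //.
by rewrite faceS [take k.+2 _]/= faceS [LHS]/= IHw.
Qed.

Lemma drop_face_ge k i w : (i <= k)%N -> (k < size w)%N ->
  drop k (face i w) = drop k.+1 w.
Proof.
elim: w k i => [|x w IHw] k [|i] //.
case: w IHw => [|y w] IHw //; case: k => [|k] // le_ik lt_kw.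
case: i le_ik => [|i] le_ik //.
by rewrite faceS [LHS]/= IHw.
Qed.

Lemma face_take k w : (k < size w)%N -> face k.+1 (take k.+1 w) = take k w.
Proof.
elim: w k => [|x w IHw] [|k] // lt_kw; first by rewrite /= !take0 face_last.
case: w IHw lt_kw => [|y w] // IHw lt_kw.
by rewrite [RHS]/= -IHw // [take k.+2 _]/= faceS.
Qed.

Lemma face0_drop k w : (k < size w)%N -> face 0 (drop k w) = drop k.+1 w.
Proof.
by elim: w k => [|x w IHw] [|k] // lt_kw; rewrite ?[LHS]IHw //= !drop0 face0.
Qed.

(* (d f)(x_1..x_(m+1)) = f(x_2..x_(m+1))                                      *)
(*    + sum_(0 < i <= m) (-1)^i f(x_1..x_i x_(i+1)..x_(m+1))                  *)
(*    + (-1)^(m+1) f(x_1..x_m),                                               *)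
(* the coefficients [R] being a trivial [G]-module.                           *)
Definition diff f w : R :=
  if w is [::] then 0 else \sum_(i < (size w).+1) (-1) ^+ i * f (face i w).

Lemma diffE f w : (0 < size w)%N ->
  diff f w = \sum_(i < (size w).+1) (-1) ^+ i * f (face i w).
Proof. by case: w. Qed.

Lemma diffD f g w : diff (fun v => f v + g v) w = diff f w + diff g w.
Proof.
case: w => [|x w] /=; first by rewrite addr0.
by rewrite -big_split; apply: eq_bigr => i _; rewrite mulrDr.
Qed.

Lemma diffN f w : diff (fun v => - f v) w = - diff f w.
Proof.
case: w => [|x w] /=; first by rewrite oppr0.
by rewrite -sumrN; apply: eq_bigr => i _; rewrite mulrN.
Qed.

Lemma diff_diff f w : diff (diff f) w = 0.
Proof.
have [w_gt1|] := ltnP 1 (size w); last first.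
  case: w => [|x [|y w]] // _ /=.
  by rewrite !big_ord_recl big_ord0 /= !mulr0 !addr0.
have w_gt0 : (0 < size w)%N by apply: ltnW.
set m := size w in w_gt0 w_gt1.
pose T i j := (-1) ^+ i * ((-1) ^+ j * f (face j (face i w))).
rewrite diffE // (eq_bigr (fun i : 'I_m.+1 => \sum_(j < m) T i j)); last first.
  move=> i _; have le_im : (i <= m)%N by rewrite -ltnS.
  rewrite diffE size_face ?prednK // -?subn1 ?subn_gt0 //.
  by rewrite mulr_sumr.
transitivity (\sum_(i < m.+1) \sum_(j < m | (j < i)%N) T i j
            + \sum_(i < m.+1) \sum_(j < m | ~~ (j < i)%N) T i j).
  by rewrite -big_split; apply: eq_bigr => i _; rewrite (bigID (fun j : 'I__ => (j < i)%N)).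
rewrite big_ord_recl big_pred0 // add0r [X in _ + X]big_ord_recr /=.
rewrite [X in _ + (_ + X)]big_pred0 => [|j]; last by rewrite ltn_ord.
rewrite addr0 [X in _ + X](exchange_big_dep xpredT) //= -big_split /=.
apply: big1 => i _; rewrite -[X in _ + X]opprK -sumrN; apply/eqP; rewrite subr_eq0.
apply/eqP; apply: eq_big => j; first by rewrite -leqNgt.
rewrite /bump /= add1n ltnS => le_ji; rewrite /T face_face ?ltnS //.
by rewrite exprS mulN1r mulNr mulrCA.
Qed.

Lemma sum_ord_gt (F : nat -> R) k m : (k < m)%N ->
  \sum_(i < m.+1 | ~~ (i <= k)%N) F i = \sum_(i < m - k) F (k.+1 + i)%N.
Proof.
move=> lt_km; rewrite -(big_mkord (fun i => ~~ (i <= k)%N) F).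
rewrite (@big_cat_nat _ _ _ k.+1) //=; last exact: ltnW.
rewrite big_nat_cond big_pred0 ?add0r => [|i]; last first.
  by rewrite ltnS; case: (i <= k)%N.
rewrite [LHS]big_nat_cond (eq_bigl (fun i => (k < i < m.+1)%N && true)); last first.
  by move=> i; rewrite -ltnNge andbT; case: (k < i)%N; rewrite ?andbF ?andbT.
rewrite -big_nat_cond -{1}[k.+1]add0n big_addn subSS big_mkord.
by apply: eq_bigr => i _; rewrite addnC.
Qed.

Definition alt_sign f w : R := (-1) ^+ size w * f w.

Lemma diff_cup f g w : diff (cup f g) w = cup (diff f) g w + cup (alt_sign f) (diff g) w.
Proof.
case: (posnP (size w)) => [/size0nil->|w_gt0].
  by rewrite !cup_nil /= mul0r mulr0 addr0.
set m := size w in w_gt0.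
rewrite diffE // -/m.
have -> : cup (diff f) g w = \sum_(k < m)
    ((\sum_(i < m.+1 | (i <= k)%N) (-1) ^+ i * f (face i (take k.+1 w)))
       * g (drop k.+1 w)
     - (-1) ^+ k * f (take k w) * g (drop k.+1 w)).
  rewrite /cup -/m big_ord_recl take0 mul0r add0r; apply: eq_bigr => k _.
  rewrite lift0.
  have szk : size (take k.+1 w) = k.+1 by rewrite size_takel.
  rewrite diffE szk // big_ord_recr /= mulrDl; congr (_ * _ + _).
    by rewrite (big_ord_widen m.+1
                  (fun i => (-1) ^+ i * f (face i (take k.+1 w)))) // ltnS ltnW.
  by rewrite exprS mulN1r !mulNr face_take.
have -> : cup (alt_sign f) (diff g) w = \sum_(k < m)
    ((-1) ^+ k * f (take k w) * g (drop k.+1 w)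
     + \sum_(i < m.+1 | ~~ (i <= k)%N)
         (-1) ^+ i * (f (take k w) * g (face (i - k) (drop k w)))).
  rewrite /cup -/m big_ord_recr /= [drop m w]drop_size /= mulr0 addr0.
  apply: eq_bigr => k _.
  have lt_km := ltn_ord k.
  rewrite /alt_sign size_takel; last exact: ltnW.
  rewrite diffE size_drop ?subn_gt0 //.
  rewrite -/m big_ord_recl expr0 mul1r mulrDr; congr (_ * g _ + _).
    by rewrite face0_drop.
  rewrite (sum_ord_gt (fun i => (-1) ^+ i *
    (f (take k w) * g (face (i - k) (drop k w))))) // mulr_sumr; apply: eq_bigr => i _.
  rewrite lift0 addSnnS addKn exprD !mulrA; congr (_ * _).
  by rewrite mulrAC.
rewrite -big_split /=.
transitivity (\sum_(i < m.+1) \sum_(k < m) (-1) ^+ i *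
    (f (take k (face i w)) * g (drop k (face i w)))).
  apply: eq_bigr => i _; have le_im : (i <= m)%N by rewrite -ltnS.
  by rewrite /cup size_face // prednK // mulr_sumr.
rewrite exchange_big; apply: eq_bigr => k _ /=.
rewrite (bigID (fun i : 'I_ _ => (i <= k)%N)) /= addrA subrK; congr (_ + _).
  rewrite mulr_suml; apply: eq_bigr => i le_ik.
  by rewrite take_face_ge // drop_face_ge // mulrA.
apply: eq_bigr => i; rewrite -ltnNge => lt_ki.
by have le_im := ltn_ord i; rewrite take_face_lt // drop_face_lt.
Qed.

Lemma bounded_diff c : bounded (diff c).
Proof.
have [N cN] := cochain_bounded c; apply/asboolP; exists N.+1 => w Nw.
rewrite diffE ?(leq_trans _ Nw) // big1 // => i _.
have le_iw : (i <= size w)%N by rewrite -ltnS.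
by rewrite cN ?mulr0 // size_face // ltn_predRL.
Qed.

Lemma bounded_alt c : bounded (alt_sign c).
Proof.
have [N cN] := cochain_bounded c; apply/asboolP; exists N => w Nw.
by rewrite /alt_sign cN ?mulr0.
Qed.

Definition coboundary c : cochain := Cochain (bounded_diff c).
Definition alternate c : cochain := Cochain (bounded_alt c).

Lemma coboundary_is_zmod_morphism : zmod_morphism coboundary.
Proof.
move=> c1 c2; apply: cochain_eq => w.
by rewrite cochainBE -diffN -[RHS]diffD.
Qed.
HB.instance Definition _ := GRing.isZmodMorphism.Build cochain cochain
  coboundary coboundary_is_zmod_morphism.

Lemma coboundaryK c : coboundary (coboundary c) = 0.
Proof. by apply: cochain_eq => w; apply: diff_diff. Qed.

Lemma coboundaryM c1 c2 :
  coboundary (c1 * c2) = coboundary c1 * c2 + alternate c1 * coboundary c2.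
Proof. by apply: cochain_eq => w; apply: diff_cup. Qed.

Lemma coboundary1 : coboundary 1 = 0.
Proof.
apply: cochain_eq => -[|x [|y w]] //=.
  rewrite !big_ord_recl big_ord0 /= /cup_unit /=.
  by rewrite expr1 expr0 mulN1r addr0 mul1r subrr.
apply: big1 => i _; have le_iw : (i <= size [:: x, y & w])%N := ltn_ord i.
by rewrite /cup_unit -size_eq0 size_face //= mulr0.
Qed.

Lemma alternateK : involutive alternate.
Proof.
move=> c; apply: cochain_eq => w.
by rewrite /= /alt_sign /= /alt_sign mulrA -exprMn mulrNN mulr1 expr1n mul1r.
Qed.

Lemma coboundary_alternate c :
  coboundary (alternate c) = - alternate (coboundary c).
Proof.
apply: cochain_eq => -[|x w]; first by rewrite cochainNE /= /alt_sign /= mulr0 oppr0.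
rewrite cochainNE /= /alt_sign /= mulr_sumr -sumrN; apply: eq_bigr => i _.
have le_iw : (i <= size (x :: w))%N := ltn_ord i.
rewrite size_face // [(size _).-1]/= exprS mulN1r mulNr opprK.
by rewrite !mulrA [_ * _ ^+ size w]mulrC.
Qed.

Definition cocycle_pred : {pred cochain} := fun c => coboundary c == 0.

Lemma cocycle_subring_closed : subring_closed cocycle_pred.
Proof.
split=> [|c1 c2 /eqP dc1 /eqP dc2|c1 c2 /eqP dc1 /eqP dc2]; apply/eqP.
- exact: coboundary1.
- by rewrite raddfB /= dc1 dc2 subrr.
- by rewrite coboundaryM dc1 dc2 mul0r mulr0 addr0.
Qed.
HB.instance Definition _ :=
  GRing.isSubringClosed.Build cochain cocycle_pred cocycle_subring_closed.

Record cocycle :=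
  Cocycle { cocycle_val :> cochain; cocycleP : cocycle_pred cocycle_val }.
HB.instance Definition _ := [isSub for cocycle_val].
HB.instance Definition _ := [Choice of cocycle by <:].
HB.instance Definition _ := GRing.SubChoice_isSubPzRing.Build
  cochain cocycle_pred cocycle cocycle_subring_closed.

Implicit Types z : cocycle.

Lemma coboundary_cocycle z : coboundary z = 0.
Proof. exact/eqP/(cocycleP z). Qed.

Definition exact_pred : {pred cocycle} := fun z =>
  `[< exists c, coboundary c = z >].

Lemma exact_zmod_closed : zmod_closed exact_pred.
Proof.
split=> [|z1 z2 /asboolP[c1 dc1] /asboolP[c2 dc2]]; apply/asboolP.
  by exists 0; rewrite raddf0.
by exists (c1 - c2); rewrite raddfB /= dc1 dc2.
Qed.
HB.instance Definition _ :=
  GRing.isZmodClosed.Build cocycle exact_pred exact_zmod_closed.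

Lemma exactMl z1 z2 : z1 \in exact_pred -> z1 * z2 \in exact_pred.
Proof.
move=> /asboolP[c dc]; apply/asboolP; exists (c * (z2 : cochain)).
by rewrite coboundaryM coboundary_cocycle mulr0 addr0 dc.
Qed.

Lemma exactMr z1 z2 : z2 \in exact_pred -> z1 * z2 \in exact_pred.
Proof.
move=> /asboolP[c dc]; apply/asboolP; exists (alternate z1 * c).
rewrite coboundaryM coboundary_alternate coboundary_cocycle alternateK dc.
have -> : alternate (0 : cochain) = 0.
  by apply: cochain_eq => w; apply: mulr0.
by rewrite oppr0 mul0r add0r.
Qed.

(* The cohomology ring [H^*(G, R)], as the direct sum of all the [H^m(G, R)]. *)
Definition cohomology := Quotient.quot exact_pred.
HB.instance Definition _ := GRing.Zmodule.on cohomology.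
HB.instance Definition _ := EqQuotient.on cohomology.
HB.instance Definition _ := ZmodQuotient.on cohomology.

Implicit Types u v : cohomology.

Definition coh_class z : cohomology := \pi_cohomology z.

Lemma classP z1 z2 :
  coh_class z1 = coh_class z2 <-> exists c, coboundary c = cocycle_val z1 - z2.
Proof.
split=> [/eqP|E]; last by apply/eqP; rewrite -Quotient.idealrBE; apply/asboolP.
by rewrite -Quotient.idealrBE => /asboolP.
Qed.

Lemma class_repr u : coh_class (repr u) = u. Proof. exact: reprK. Qed.

Lemma class_ind (P : cohomology -> Prop) :
  (forall z, P (coh_class z)) -> forall u, P u.
Proof. by move=> Pz u; rewrite -[u]class_repr. Qed.

Definition cohomology_mul u v := coh_class (repr u * repr v).

Lemma classM z1 z2 : coh_class (z1 * z2) = cohomology_mul (coh_class z1) (coh_class z2).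
Proof.
have repr_class z : repr (coh_class z) - z \in exact_pred.
  by rewrite Quotient.idealrBE; apply/eqP; apply: class_repr.
apply/esym/eqP; rewrite -Quotient.idealrBE -[_ - _](subrKA (repr (coh_class z1) * z2)).
rewrite -mulrBr -mulrBl; apply: rpredD.
  exact/exactMr/repr_class.
exact/exactMl/repr_class.
Qed.

Lemma class_is_zmod_morphism : zmod_morphism coh_class.
Proof. exact: (pi_is_zmod_morphism cohomology). Qed.
HB.instance Definition _ := GRing.isZmodMorphism.Build cocycle cohomology
  coh_class class_is_zmod_morphism.

Fact cohomology_mulA : associative cohomology_mul.
Proof.
elim/class_ind=> z1; elim/class_ind=> z2; elim/class_ind=> z3.
by rewrite -!classM mulrA.
Qed.
Fact cohomology_mul1 : left_id (coh_class 1) cohomology_mul.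
Proof. by elim/class_ind=> z; rewrite -classM mul1r. Qed.
Fact cohomology_1mul : right_id (coh_class 1) cohomology_mul.
Proof. by elim/class_ind=> z; rewrite -classM mulr1. Qed.
Fact cohomology_mulDl : left_distributive cohomology_mul +%R.
Proof.
elim/class_ind=> z1; elim/class_ind=> z2; elim/class_ind=> z3.
by rewrite -raddfD -!classM mulrDl raddfD.
Qed.
Fact cohomology_mulDr : right_distributive cohomology_mul +%R.
Proof.
elim/class_ind=> z1; elim/class_ind=> z2; elim/class_ind=> z3.
by rewrite -raddfD -!classM mulrDr raddfD.
Qed.
HB.instance Definition _ := GRing.Zmodule_isPzRing.Build cohomology
  cohomology_mulA cohomology_mul1 cohomology_1mul
  cohomology_mulDl cohomology_mulDr.

Lemma class_is_monoid_morphism : monoid_morphism coh_class.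
Proof. by split=> // z1 z2; apply: classM. Qed.
HB.instance Definition _ := GRing.isMonoidMorphism.Build cocycle cohomology
  coh_class class_is_monoid_morphism.

Local Open Scope classical_set_scope.

Definition coh_degree (m : nat) : set cohomology :=
  [set u | exists2 z : cocycle, homogeneous m z & u = coh_class z].

(* [H^1 = Hom(G, R)] generates the exterior part: this is the [R]-span of the *)
(* products of [k] classes of degree 1, for [R] a prime field (every element  *)
(* of which is a multiple of 1, so that additive spans are [R]-spans).        *)
Definition exterior_power k : set cohomology :=
  [set u | exists r, exists2 a : 'I_r -> 'I_k -> cohomology,
     (forall i j, coh_degree 1%N (a i j)) & u = \sum_i \prod_j a i j].

Definition two_sided_ideal (I : set cohomology) : Prop :=
  [/\ I 0, forall u v, I u -> I v -> I (u + v),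
      forall u v, I v -> I (u * v) & forall u v, I u -> I (u * v)].

End Cochains.

Arguments face : simpl never.

Section Restriction.
Variables (R : comNzRingType) (G : finGroupType) (W : {group G}).
Implicit Types (c : cochain R G) (z : cocycle R G).

Lemma face_map i (w : seq (subg_of W)) :
  face i (map sgval w) = map sgval (face i w).
Proof.
elim: w i => [|x w IHw] [|[|i]] //; case: w IHw => [|y w] IHw //.
by rewrite ![map _ _]/= !faceS /= -IHw.
Qed.

Lemma bounded_restriction c :
  bounded (fun w : seq (subg_of W) => c (map sgval w)).
Proof.
have [N cN] := cochain_bounded c.
by apply/asboolP; exists N => w Nw; apply: cN; rewrite size_map.
Qed.

Definition cochain_restriction c : cochain R (subg_of W) :=
  Cochain (bounded_restriction c).

Lemma coboundary_restriction c :
  coboundary (cochain_restriction c) = cochain_restriction (coboundary c).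
Proof.
apply: cochain_eq => -[|x w] //.
rewrite [LHS]/= [RHS]/= size_map; apply: eq_bigr => i _.
by rewrite -face_map.
Qed.

Lemma cocycle_restriction_subproof z :
  cocycle_pred (cochain_restriction z).
Proof.
apply/eqP; rewrite coboundary_restriction coboundary_cocycle.
exact: cochain_eq.
Qed.

Definition cocycle_restriction z : cocycle R (subg_of W) :=
  Cocycle (cocycle_restriction_subproof z).

Definition restriction (u : cohomology R G) : cohomology R (subg_of W) :=
  coh_class (cocycle_restriction (repr u)).

Lemma restriction_class z :
  restriction (coh_class z) = coh_class (cocycle_restriction z).
Proof.
have /classP[c dc] := class_repr (coh_class z); apply/classP.
exists (cochain_restriction c); rewrite coboundary_restriction dc.
exact: cochain_eq.
Qed.

End Restriction.

Section Bockstein.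
Variables (p : nat) (G : finGroupType).

Section Map.
Variables (R S : comNzRingType) (f : R -> S) (f0 : f 0 = 0).

Lemma bounded_map (c : cochain R G) : bounded (fun w => f (c w)).
Proof.
have [N cN] := cochain_bounded c.
by apply/asboolP; exists N => w /cN ->.
Qed.

Definition map_cochain c : cochain S G := Cochain (bounded_map c).
End Map.

Definition reduce_cochain : cochain int G -> cochain 'F_p G :=
  map_cochain (f := fun k : int => k%:~R : 'F_p) erefl.

Definition lift_cochain : cochain 'F_p G -> cochain int G :=
  map_cochain (f := fun a : 'F_p => (a : nat)%:Z) erefl.

Definition divide_cochain : cochain int G -> cochain int G :=
  map_cochain (f := fun k : int => (k %/ p)%Z) (div0z p).

(* The connecting homomorphism of 0 -> Z/p -> Z/p^2 -> Z/p -> 0: lift a       *)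
(* cocycle to Z/p^2 (here even to Z), take its coboundary and divide by [p].  *)
(* For [p] prime the result is a cocycle, so that the default value of        *)
(* [insubd] is not used; see [bockstein_class].                               *)
Definition bockstein (u : cohomology 'F_p G) : cohomology 'F_p G :=
  coh_class (insubd 0
    (reduce_cochain (divide_cochain (coboundary (lift_cochain (repr u)))))).

Hypothesis p_pr : prime p.

Lemma lift_cochainK : cancel lift_cochain reduce_cochain.
Proof. by move=> c; apply: cochain_eq => w; rewrite /= -pmulrn natr_Zp. Qed.

Lemma reduceB c1 c2 :
  reduce_cochain (c1 - c2) = reduce_cochain c1 - reduce_cochain c2.
Proof. by apply: cochain_eq => w; apply: rmorphB. Qed.

Lemma reduceD c1 c2 :
  reduce_cochain (c1 + c2) = reduce_cochain c1 + reduce_cochain c2.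
Proof. by apply: cochain_eq => w; apply: rmorphD. Qed.

Lemma coboundary_reduce c :
  coboundary (reduce_cochain c) = reduce_cochain (coboundary c).
Proof.
apply: cochain_eq => -[|x w] //; rewrite [LHS]/= [RHS]/= rmorph_sum.
by apply: eq_bigr => i _; rewrite rmorphM rmorphXn rmorphN1.
Qed.

Lemma intr_Fp_eq0 (k : int) : ((k%:~R : 'F_p) == 0) = (p %| k)%Z.
Proof.
have charp := pchar_Fp p_pr; rewrite dvdzE.
by case: k => k;
  rewrite ?NegzE ?mulrNz ?oppr_eq0 ?abszN -pmulrn -(dvdn_pcharf charp).
Qed.

Lemma cochainMnE (R : comNzRingType) (c : cochain R G) k w :
  (c *+ k) w = c w *+ k.
Proof. by elim: k => [|k IHk] //; rewrite !mulrS -IHk. Qed.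

Lemma divide_cochainK c : divide_cochain (c *+ p) = c.
Proof.
apply: cochain_eq => w; rewrite /= cochainMnE -mulr_natr natz mulzK //.
by rewrite eqz_nat -lt0n prime_gt0.
Qed.

Lemma reduce_eq0 c : reduce_cochain c = 0 -> c = divide_cochain c *+ p.
Proof.
move=> c0; apply: cochain_eq => w; rewrite cochainMnE -mulr_natr natz.
apply/esym/divzK; rewrite -intr_Fp_eq0.
by rewrite -[_%:~R]/(reduce_cochain c w) c0.
Qed.

Lemma bockstein_class (z z' : cocycle 'F_p G) (c b : cochain int G) :
  reduce_cochain c = z -> coboundary c = b *+ p -> reduce_cochain b = z' ->
  bockstein (coh_class z) = coh_class z'.
Proof.
move=> cz dc bz'; set z0 := repr (coh_class z).
have /classP[e de] : coh_class z0 = coh_class z by apply: class_repr.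
have /reduce_eq0 :
    reduce_cochain (lift_cochain z0 - c - coboundary (lift_cochain e)) = 0.
  by rewrite !reduceB -coboundary_reduce !lift_cochainK cz de subrr.
set t := divide_cochain _ => Dt.
have {Dt} Dz0 : coboundary (lift_cochain z0) = (b + coboundary t) *+ p.
  have -> : lift_cochain z0 = t *+ p + (c + coboundary (lift_cochain e)).
    by rewrite -Dt [c + _]addrC addrA !subrK.
  by rewrite !raddfD /= coboundaryK addr0 raddfMn dc mulrnDl addrC.
have Db : reduce_cochain (divide_cochain (coboundary (lift_cochain z0))) =
    cocycle_val z' + coboundary (reduce_cochain t).
  by rewrite Dz0 divide_cochainK reduceD bz' coboundary_reduce.
rewrite /bockstein -/z0 Db; apply/classP; exists (reduce_cochain t).
rewrite insubdK ?(addrC (cocycle_val z')) ?addrK //.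
by apply/eqP; rewrite raddfD /= coboundary_cocycle coboundaryK addr0.
Qed.

End Bockstein.

Local Open Scope classical_set_scope.

Section Essential.
Variables (p : nat) (V : finGroupType).

Local Notation H := (cohomology 'F_p V).

Definition Ess : set H :=
  [set u | forall W : {group V}, W \proper [set: V]%SET -> restriction W u = 0].

(* The reduced powers [P m = P^m] on [H^*(V, F_p)], [V] elementary abelian:   *)
(* these conditions determine them, as [H^*(V, F_p)] is generated by the      *)
(* classes [a] of degree 1 and their Bocksteins.                              *)
Record reduced_powers (P : nat -> H -> H) : Prop := ReducedPowers {
  reduced_powerD : forall m u v, P m (u + v) = P m u + P m v;
  reduced_power_cartan : forall m u v,
    P m (u * v) = \sum_(i < m.+1) P i u * P (m - i)%N v;
  reduced_power0 : forall u, P 0%N u = u;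
  reduced_power_deg1 : forall m a, (0 < m)%N -> coh_degree 1%N a -> P m a = 0;
  reduced_power1_bockstein : forall a, coh_degree 1%N a ->
    P 1%N (bockstein a) = bockstein a ^+ p;
  reduced_power_bockstein : forall m a, (1 < m)%N -> coh_degree 1%N a ->
    P m (bockstein a) = 0
}.

(* The Steenrod algebra is generated by the Bockstein and the [P m]. *)
Definition steenrod_stable (P : nat -> H -> H) (I : set H) : Prop :=
  (forall u, I u -> I (bockstein u)) /\ (forall m u, I u -> I (P m u)).

Definition steenrod_closure (P : nat -> H -> H) (X : set H) : set H :=
  smallest [set I | two_sided_ideal I /\ steenrod_stable P I] X.

Lemma steenrod_closure_stable P X :
  two_sided_ideal (steenrod_closure P X) /\
  steenrod_stable P (steenrod_closure P X).
Proof.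
split; split.
- by move=> I [[[]]].
- move=> u v Xu Xv I CI; have [[[_ ID _ _] _] _] := CI.
  by apply: ID; [apply: Xu | apply: Xv].
- move=> u v Xv I CI; have [[[_ _ IM _] _] _] := CI.
  by apply: IM; apply: Xv.
- move=> u v Xu I CI; have [[[_ _ _ IM] _] _] := CI.
  by apply: IM; apply: Xu.
- by move=> u Xu I CI; have [[_ [Ib _]] _] := CI; apply: Ib; apply: Xu.
- by move=> m u Xu I CI; have [[_ [_ IP]] _] := CI; apply: IP; apply: Xu.
Qed.

End Essential.

Arguments Ess : clear implicits.
Arguments exterior_power : clear implicits.

(* Main.v *)
(* For a nonzero b : V -> F_p with kernel W, let a_b in H^1(V) be its class and
   x_b = beta a_b. Comparing the homogeneous cochains invariant under V with
   those invariant under W shows that the restriction to W has kernel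
   a_b inf H^*(W) + x_b H^*(V), that this sum is direct and that x_b is regular.
   Hence H^*(V) is generated by the a_b and the x_b, the x_b are central, and f
   is essential if and only if f lies in (a_b, x_b) for all nonzero b.

   The Milnor operations Q_0 = beta, Q_(i+1) = [P^(p^i), Q_i] are antiderivations
   with Q_i a_b = x_b^(p^i) and Q_i x_b = 0. Let a_1, ..., a_n be a basis of H^1,
   let e_k(X) be the product of all X - x_b, for b in the span of the first k - 1
   basis elements, and let e_k = e_k(x_k). The polynomial e_k(X) is additive, so
   some combination R_k of Milnor operations, with coefficients polynomials in
   the x_b, satisfies R_k a_b = e_k(x_b); it kills a_1, ..., a_(k-1) and maps a_k
   to e_k. The product D = e_1 ... e_n runs over representatives of all lines of
   linear forms.

   Let f be essential and let I be an ideal stable under the Steenrod algebra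
   that contains all products of n classes of degree 1. Then a_1 ... a_n f is
   divisible by each x_b, hence by D, and the quotient is annihilated by H^1,
   hence is a multiple of a product of n classes of degree 1. Thus a_1 ... a_n f
   lies in D I. As e_k g = R_k (a_k g) + a_k R_k g, descending induction on k
   gives e_k ... e_n a_1 ... a_(k-1) f in D I for all essential f. For k = 1 this
   says that D f lies in D I, and D is regular, so f lies in I.                *)
Require Import Defs.
From HB Require Import structures.
From mathcomp Require Import all_boot all_fingroup all_solvable.
From mathcomp Require Import all_algebra mxabelem finfield.
From mathcomp Require Import generic_quotient zify ring.
From mathcomp Require Import boolp classical_sets functions.

Set Implicit Arguments.
Unset Strict Implicit.
Unset Printing Implicit Defensive.

Section HomogeneousDiff.
Import GRing.Theory.
Local Open Scope ring_scope.
Variables (R : comNzRingType) (T : Type).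
Implicit Types (F : seq T -> R) (v w : seq T).

Lemma funBE F1 F2 v : (F1 - F2) v = F1 v - F2 v. Proof. by []. Qed.
Lemma funDE F1 F2 v : (F1 + F2) v = F1 v + F2 v. Proof. by []. Qed.

Lemma funNE F v : (- F) v = - F v. Proof. by []. Qed.

(* The alternating sum over the deletions of one entry, see [hdiffE]. On
   singletons it involves [F [::]], which is [0] for actual cochains.          *)
Fixpoint hdiff F v : R :=
  if v is x :: w then F w - hdiff (fun u => F (x :: u)) w else 0.

Lemma hdiff_is_zmod_morphism : zmod_morphism hdiff.
Proof.
move=> F1 F2; apply/funext => v; rewrite funBE.
elim: v F1 F2 => [|x v IHv] F1 F2 /=; first by rewrite subr0.
by rewrite (IHv (fun u => F1 (x :: u)) (fun u => F2 (x :: u))) funBE; ring.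
Qed.
HB.instance Definition _ :=
  GRing.isZmodMorphism.Build (seq T -> R) (seq T -> R) hdiff
    hdiff_is_zmod_morphism.

Lemma hdiffB F1 F2 : hdiff (F1 - F2) = hdiff F1 - hdiff F2.
Proof. exact: raddfB. Qed.

Lemma hdiff_hdiff F : hdiff (hdiff F) = 0.
Proof.
apply/funext => v; elim: v F => [|x v IHv] F //=.
by rewrite (hdiffB F (hdiff (fun u => F (x :: u)))) funBE IHv subr0 subrr.
Qed.

Fixpoint prism (rho : T -> T) F v : R :=
  if v is x :: w then
    F (x :: map rho v) - prism rho (fun u => F (x :: u)) w
  else 0.

Lemma prism_is_zmod_morphism rho : zmod_morphism (prism rho).
Proof.
move=> F1 F2; apply/funext => v; rewrite funBE.
elim: v F1 F2 => [|x v IHv] F1 F2 /=; first by rewrite subr0.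
by rewrite (IHv (fun u => F1 (x :: u)) (fun u => F2 (x :: u))) !funBE; ring.
Qed.
HB.instance Definition _ rho :=
  GRing.isZmodMorphism.Build (seq T -> R) (seq T -> R) (prism rho)
    (prism_is_zmod_morphism rho).

Lemma prismB rho F1 F2 : prism rho (F1 - F2) = prism rho F1 - prism rho F2.
Proof. exact: raddfB. Qed.

End HomogeneousDiff.

Section HomogeneousComp.
Import GRing.Theory.
Local Open Scope ring_scope.
Variables (R : comNzRingType) (S T : Type).

Definition hpull (phi : S -> T) (F : seq T -> R) : seq S -> R :=
  fun v => F (map phi v).

Lemma hpull_is_zmod_morphism phi : zmod_morphism (hpull phi).
Proof. by []. Qed.
HB.instance Definition _ phi :=
  GRing.isZmodMorphism.Build (seq T -> R) (seq S -> R) (hpull phi)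
    (hpull_is_zmod_morphism phi).

Lemma hdiff_hpull phi F : hdiff (hpull phi F) = hpull phi (hdiff F).
Proof.
apply/funext => v; elim: v F => [|x v IHv] F //=.
by rewrite -[fun u => _]/(hpull phi (fun u => F (phi x :: u))) IHv.
Qed.
End HomogeneousComp.

Section PrismHomotopy.
Import GRing.Theory.
Local Open Scope ring_scope.
Variables (R : comNzRingType) (T : Type) (rho : T -> T).
Implicit Types (F : seq T -> R) (v w : seq T).

Lemma prismP F : hdiff (prism rho F) + prism rho (hdiff F) = hpull rho F - F.
Proof.
apply/funext => v; rewrite funDE funBE /hpull; elim: v F => [|x v IHv] F /=.
  by rewrite subrr addr0.
pose Fx : seq T -> R := fun u => F (x :: u).
pose Fxx : seq T -> R := fun u => F [:: x, rho x & u].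
rewrite -/Fx -/Fxx -[fun u => _ - prism _ _ _]/(hpull rho Fxx - prism rho Fx).
rewrite -[fun u => _ - hdiff _ _]/(F - hdiff Fx) hdiffB hdiff_hpull prismB !funBE.
rewrite -[prism rho (hdiff Fx) v](addKr (hdiff (prism rho Fx) v)) IHv /hpull /Fx.
by ring.
Qed.
End PrismHomotopy.
Section HomogeneousCup.
Import GRing.Theory.
Local Open Scope ring_scope.
Variables (R : comNzRingType) (T : Type).
Implicit Types (F : seq T -> R) (v w : seq T).

Lemma hdiffZ a F v : hdiff (fun u => a * F u) v = a * hdiff F v.
Proof.
elim: v F => [|x v IHv] F /=; first by rewrite mulr0.
by rewrite (IHv (fun u => F (x :: u))) mulrBr.
Qed.

Definition hcup0 (d : T -> R) F v : R := if v is x :: _ then d x * F v else 0.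

Definition hcup1 (e : T -> T -> R) F v : R :=
  if v is x :: ((y :: _) as w) then e x y * F w else 0.

Definition hcup2 (e : T -> T -> T -> R) F v : R :=
  if v is x :: y :: ((z :: _) as w) then e x y z * F w else 0.

Lemma hdiff_hcup0 d F : hdiff F = 0 ->
  hdiff (hcup0 d F) = hcup1 (fun x y => d y - d x) F.
Proof.
move=> dF; apply/funext => -[|x [|y v]] //=; first by rewrite subr0.
have /= := congr1 (fun K => K [:: x, y & v]) dF.
rewrite (hdiffZ (d x) (fun u => F [:: x, y & u])) -[X in _ = X -> _]/0.
by move/eqP; rewrite subr_eq0 => /eqP E; ring: E.
Qed.

Lemma hdiff_hcup1 e F : hdiff F = 0 ->
  hdiff (hcup1 e F) = hcup2 (fun x y z => e y z - e x z + e x y) F.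
Proof.
move=> dF; apply/funext => -[|x [|y [|z v]]] //=; rewrite ?subr0 //.
have /= := congr1 (fun K => K [:: y, z & v]) dF.
rewrite (hdiffZ (e x y) (fun u => F [:: y, z & u])) -[X in _ = X -> _]/0.
by move/eqP; rewrite subr_eq0 => /eqP E; ring: E.
Qed.
End HomogeneousCup.

Section Translation.
Import GRing.Theory.
Local Open Scope ring_scope.
Variables (R : comNzRingType) (G : finGroupType).
Implicit Types (F : seq G -> R) (g : G) (H : pred G).

Definition shift g F := hpull (fun x => g * x)%g F.

Definition invariant_by H F := F [::] = 0 /\ forall g, H g -> shift g F = F.

Lemma shiftM g h F : shift g (shift h F) = shift (h * g)%g F.
Proof.
apply/funext => v; rewrite /shift /hpull -map_comp; congr (F _).
by apply: eq_map => x; rewrite /= mulgA.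
Qed.

Lemma shiftB g F1 F2 : shift g (F1 - F2) = shift g F1 - shift g F2.
Proof. by []. Qed.

Lemma hdiff_shift g F : hdiff (shift g F) = shift g (hdiff F).
Proof. exact: hdiff_hpull. Qed.

Lemma invB H F1 F2 : invariant_by H F1 -> invariant_by H F2 -> invariant_by H (F1 - F2).
Proof.
move=> [F1n F1H] [F2n F2H]; split=> [|g Hg]; first by rewrite funBE F1n F2n subrr.
by rewrite shiftB F1H ?F2H.
Qed.

Lemma invN H F : invariant_by H F -> invariant_by H (- F).
Proof. by rewrite -sub0r; apply: invB; split. Qed.

Lemma inv_hdiff H F : invariant_by H F -> invariant_by H (hdiff F).
Proof. by case=> Fn FH; split=> // g Hg; rewrite -hdiff_shift FH. Qed.
End Translation.

Section HomogeneousSplit.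
Import GRing.Theory.
Local Open Scope ring_scope.
Variables (p : nat) (p_pr : prime p) (G : finGroupType).
Variables (chi : G -> 'F_p) (rho : G -> G) (t : G).
Hypothesis mulGC : forall x y : G, (x * y = y * x)%g.
Hypothesis t_p : (t ^+ p = 1)%g.
Hypothesis chiM : forall x y, chi (x * y)%g = chi x + chi y.
Hypothesis chit : chi t = 1.
Hypothesis rhoE : forall x, rho x = (x * t ^- (chi x))%g.
Implicit Types (F : seq G -> 'F_p) (v w : seq G) (x y z g : G).

Let Fp_p : (Zp_trunc (pdiv p)).+2 = p. Proof. exact: Fp_cast. Qed.

Let chi1 : chi 1%g = 0.
Proof. by apply: (@addrI _ (chi 1%g)); rewrite -chiM mulg1 addr0. Qed.

Let T (j : 'F_p) : G := (t ^+ j)%g.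

Let expgt_mod m : (t ^+ (m %% p) = t ^+ m)%g.
Proof. by rewrite {2}(divn_eq m p) expgD mulnC expgM t_p expg1n mul1g. Qed.

Let TD i j : T (i + j) = (T i * T j)%g.
Proof. by rewrite /T -expgD -[RHS]expgt_mod /= [X in (_ %% X)%N]Fp_p. Qed.

Let T0 : T 0 = 1%g. Proof. by []. Qed.

Let T1 : T 1 = t.
Proof. by rewrite /T /= Fp_p modn_small ?prime_gt1. Qed.

Let TN i : T (- i) = (T i)^-1%g.
Proof. by apply/eqP; rewrite eq_mulgV1 invgK -TD addNr. Qed.

Let chiX m : chi (t ^+ m)%g = m%:R.
Proof. by elim: m => [|m IHm]; rewrite ?chi1 // expgS chiM IHm chit -mulrS. Qed.

Let chiT j : chi (T j) = j.
Proof. by rewrite chiX natr_Zp. Qed.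

Let rhoT x : rho x = (x * T (- chi x))%g. Proof. by rewrite TN rhoE. Qed.

Let chirho x : chi (rho x) = 0.
Proof. by rewrite rhoT chiM chiT subrr. Qed.

Let rhoM x y : rho (x * y)%g = (rho x * rho y)%g.
Proof.
rewrite !rhoT chiM opprD TD !mulgA; congr (_ * _)%g.
by rewrite -!mulgA; congr (_ * _)%g; rewrite mulGC.
Qed.

Let rho_id x : chi x = 0 -> rho x = x.
Proof. by move=> x0; rewrite rhoT x0 oppr0 T0 mulg1. Qed.

Notation invW := (invariant_by (fun g => chi g == 0)).
Notation invG := (invariant_by xpredT).

Definition trace F := \sum_j shift (T j) F.

Lemma inv_shift H g F : invariant_by H F -> invariant_by H (shift g F).
Proof.
by case=> Fn FH; split=> [//|h Hh]; rewrite shiftM mulGC -shiftM FH.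
Qed.

Lemma invGW F : invG F -> invW F.
Proof. by case=> Fn FG; split=> // g _; apply: FG. Qed.

Lemma inv_rho F : invW F -> invG (hpull rho F).
Proof.
case=> Fn FW; split=> // g _; apply/funext => v.
rewrite /shift /hpull -map_comp.
rewrite -[in RHS](FW (rho g)) ?chirho // /shift /hpull -map_comp; congr (F _).
by apply: eq_map => x; rewrite /= rhoM.
Qed.

Lemma rho_rho F : hpull rho (hpull rho F) = hpull rho F.
Proof.
apply/funext => v; rewrite /hpull -map_comp; congr (F _).
by apply: eq_map => x /=; rewrite rho_id.
Qed.

Lemma inv_prism F : invW F -> invW (prism rho F).
Proof.
case=> Fn FW; split=> // g g0.
suff E (K : seq G -> 'F_p) : shift g (prism rho K) = prism rho (shift g K) by rewrite E FW.
apply/funext => v; rewrite /shift /hpull; elim: v K => [|x v IHv] K //=.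
rewrite IHv -!map_comp; congr (K (_ :: _) - _).
rewrite rhoM (rho_id (eqP g0)); congr (_ :: _).
by apply: eq_map => y; rewrite /= rhoM (rho_id (eqP g0)).
Qed.

Lemma inv_hcup0 d F : invW F -> (forall g x, chi g = 0 -> d (g * x)%g = d x) ->
  invW (hcup0 d F).
Proof.
case=> Fn FW dW; split=> // g /eqP g0; apply/funext => -[|x v] //.
by rewrite /shift /hpull /= dW // -{2}(FW g) // g0.
Qed.

Lemma inv_hcup1 (H : pred G) e F : invariant_by H F ->
  (forall g x y, H g -> e (g * x)%g (g * y)%g = e x y) -> invariant_by H (hcup1 e F).
Proof.
case=> Fn FW dW; split=> // g g0; apply/funext => -[|x [|y v]] //.
by rewrite /shift /hpull /= dW // -{2}(FW g).
Qed.

Lemma invW_t F : invW F -> shift t F = F -> invG F.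
Proof.
move=> [Fn FW] Ft; split=> // g _.
have FtX m : shift (t ^+ m)%g F = F.
  elim: m => [|m IHm]; last by rewrite expgS -shiftM Ft.
  apply/funext => v; rewrite /shift /hpull (eq_map (g := id)) ?map_id // => x.
  exact: mul1g.
have -> : g = (rho g * T (chi g))%g by rewrite rhoT TN mulgKV.
by rewrite -shiftM FW ?chirho // FtX.
Qed.

Lemma traceE F v : trace F v = \sum_j F (map (fun x => T j * x)%g v).
Proof. by rewrite /trace fct_sumE. Qed.

Lemma shift_trace F : shift t (trace F) = trace F.
Proof.
apply/funext => v; rewrite [RHS]traceE /shift /hpull traceE.
rewrite [RHS](reindex_inj (addIr 1)); apply: eq_bigr => j _.
rewrite -map_comp; congr (F _); apply: eq_map => x /=.
by rewrite TD T1 mulgA.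
Qed.

Lemma traceB F1 F2 : trace (F1 - F2) = trace F1 - trace F2.
Proof. by rewrite -sumrB. Qed.

Lemma trace_shift F : trace (shift t F) = trace F.
Proof.
rewrite -[RHS]shift_trace; apply/funext => v.
rewrite traceE [RHS]traceE; apply: eq_bigr => j _.
rewrite /shift /hpull -!map_comp; congr (F _); apply: eq_map => x /=.
by rewrite !mulgA (mulGC t).
Qed.

Lemma trace_hdiff F : trace (hdiff F) = hdiff (trace F).
Proof. by rewrite /trace raddf_sum; apply: eq_bigr => j _; rewrite -hdiff_shift. Qed.

Lemma trace_invG F : invG F -> trace F = 0.
Proof.
case=> _ FG; rewrite /trace (eq_bigr (fun=> F)) => [|j _]; last exact: FG.
rewrite sumr_const card_Fp //; apply/funext => v.
have -> (k : nat) : (F *+ k) v = F v *+ k by elim: k => // k IHk; rewrite !mulrS -IHk.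
by rewrite mulrn_pchar // pchar_Fp.
Qed.

Lemma trace_inv F : invW F -> invG (trace F).
Proof.
move=> FW; apply: invW_t (shift_trace F); split=> [|g g0].
  by rewrite traceE big1 // => j _; apply: FW.1.
rewrite {2}/trace -(eq_bigr _ (fun j _ => (inv_shift (T j) FW).2 g g0)).
by apply/funext => v; rewrite /shift /hpull traceE fct_sumE.
Qed.

Let delta x : 'F_p := (chi x == -1)%:R.
Let ltF (i j : 'F_p) : 'F_p := (i < j)%N%:R.

Let ltF_delta (i j : 'F_p) : ltF i (j + 1) - ltF i j = (i == j)%:R - (j == -1)%:R.
Proof.
have p_gt1 := prime_gt1 p_pr.
have lt_p (k : 'F_p) : (k < p)%N by rewrite -{2}Fp_p.
have E1 : nat_of_ord (1 : 'F_p) = 1%N by rewrite /= [X in (_ %% X)%N]Fp_p modn_small.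
have E : nat_of_ord (j + 1) = if j.+1 == p then 0%N else j.+1.
  rewrite -[LHS]/((j + (1%R : 'F_p)) %% _)%N E1 [X in (_ %% X)%N]Fp_p addn1.
  case: eqP => [->|jp]; first by rewrite modnn.
  by rewrite modn_small // ltn_neqAle lt_p andbT; apply/eqP.
have -> : (j == -1) = (j.+1 == p).
  by rewrite -subr_eq0 opprK -[LHS]/(nat_of_ord (j + 1) == 0%N) E; case: (j.+1 == p).
rewrite /ltF E -[i == j]/(nat_of_ord i == nat_of_ord j); have := lt_p i; have := lt_p j.
case: eqP => [jp _ lti|jp _ _]; last first.
  by rewrite ltnS; case: ltngtP => _; rewrite ?subrr ?subr0.
have {lti} : (i <= j)%N by rewrite -ltnS jp.
by rewrite ltn0; case: ltngtP => // _ _; rewrite ?subrr ?subr0.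
Qed.

Let chit1 x : chi (t * x)%g = chi x + 1.
Proof. by rewrite chiM chit addrC. Qed.

Let trace_delta F : invG F -> trace (hcup0 delta F) = F.
Proof.
move=> [Fn FG]; apply/funext => -[|x v]; rewrite traceE.
  by rewrite Fn big1.
rewrite (bigD1 (-1 - chi x)) //= big1 => [|j].
  rewrite addr0 /delta chiM chiT subrK eqxx mul1r.
  by rewrite -[RHS](congr1 (fun K => K (x :: v)) (FG (T (-1 - chi x)) isT)).
by rewrite /delta chiM chiT -(inj_eq (addIr (chi x))) subrK => /negPf->; rewrite mul0r.
Qed.

(* [F] is summed over the translates of [v] by powers of [t] whose first entry
   has a smaller [chi]-coordinate than that of [v].                            *)
Let untrace F v : 'F_p :=
  if v is x :: _ then \sum_i ltF i (chi x) * shift (T (i - chi x)) F v else 0.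

Lemma exact_trace F : invW F -> trace F = 0 ->
  exists2 K, invW K & shift t K - K = F.
Proof.
move=> [Fn FW] tF; exists (untrace F).
  split=> // g g0; apply/funext => -[|x v] //; apply: eq_bigr => i _.
  rewrite chiM (eqP g0) add0r -{2}(FW g g0).
  by rewrite [in RHS]shiftM mulGC -shiftM.
apply/funext => -[|x v]; first by rewrite funBE subrr Fn.
rewrite funBE /shift /hpull [map _ _]/= /untrace -sumrB.
transitivity (\sum_i ((i == chi x)%:R - delta x) * shift (T (i - chi x)) F (x :: v)).
  apply: eq_bigr => i _; rewrite -ltF_delta chit1 mulrBl; congr (_ * _ - _).
  rewrite -[LHS]/(shift t (shift (T (i - (chi x + 1))) F) (x :: v)) shiftM.
  by rewrite -{1}T1 -TD opprD addrA subrK.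
under eq_bigr do rewrite mulrBl.
rewrite sumrB (bigD1 (chi x)) //= big1 => [|i /negPf->]; last by rewrite mul0r.
rewrite addr0 eqxx mul1r subrr -mulr_sumr.
have -> : \sum_i shift (T (i - chi x)) F (x :: v) = trace F (x :: v).
  by rewrite traceE [RHS](reindex_inj (addIr (- chi x))).
rewrite tF mulr0 subr0 T0 /shift /hpull (eq_map (g := id)) ?map_id // => y.
exact: mul1g.
Qed.

(* [carry3], the coboundary of the [W]-invariant cochain [eps], is the integral
   coboundary of a lift of [chi], divided by [p]; and [(t - 1) eps] is the
   coboundary of [delta].                                                      *)
Let eps x y : 'F_p := ltF (chi y) (chi x).

Definition carry3 x y z : 'F_p := eps y z - eps x z + eps x y.

Let shift_hcup1 g e F : invG F ->
  shift g (hcup1 e F) = hcup1 (fun x y => e (g * x)%g (g * y)%g) F.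
Proof.
move=> [Fn FG]; apply/funext => -[|x [|y v]] //.
by rewrite /shift /hpull /= -[in RHS](FG g).
Qed.

Let shift_hcup0 g d F : invG F ->
  shift g (hcup0 d F) = hcup0 (fun x => d (g * x)%g) F.
Proof.
move=> [Fn FG]; apply/funext => -[|x v] //.
by rewrite /shift /hpull /= -[in RHS](FG g).
Qed.

Let shift_eps x y : eps (t * x)%g (t * y)%g - eps x y = delta y - delta x.
Proof.
have ltFC i j : ltF i j = 1 - ltF j i - (i == j)%:R.
  rewrite /ltF -[i == j]/(nat_of_ord i == nat_of_ord j).
  by case: ltngtP => _ /=; ring.
have E1 := ltF_delta (chi y + 1) (chi x); have E2 := ltF_delta (chi x) (chi y).
rewrite /eps !chit1 -[X in X - _](subrK (ltF (chi y + 1) (chi x))) E1.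
rewrite [ltF (chi y + 1) _]ltFC [ltF (chi y) (chi x)]ltFC.
rewrite -[ltF (chi x) (chi y + 1)](subrK (ltF (chi x) (chi y))) E2.
by rewrite /delta [chi x == chi y]eq_sym; ring.
Qed.

Let dchi x y : 'F_p := chi y - chi x.

Lemma hdiff_chi F : hdiff F = 0 -> hdiff (hcup0 chi F) = hcup1 dchi F.
Proof. exact: hdiff_hcup0. Qed.

Lemma hdiff_eps F : hdiff F = 0 -> hdiff (hcup1 eps F) = hcup2 carry3 F.
Proof. exact: hdiff_hcup1. Qed.

Lemma inv_eps F : invG F -> invW (hcup1 eps F).
Proof.
move=> FG; apply: inv_hcup1; first exact: invGW.
by move=> g x y /eqP g0; rewrite /eps !chiM g0 !add0r.
Qed.

Lemma inv_chi F : invG F -> invW (hcup0 chi F).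
Proof.
move=> FG; apply: inv_hcup0; first exact: invGW.
by move=> g x g0; rewrite chiM g0 add0r.
Qed.

Lemma inv_delta F : invG F -> invW (hcup0 delta F).
Proof.
move=> FG; apply: inv_hcup0; first exact: invGW.
by move=> g x g0; rewrite /delta chiM g0 add0r.
Qed.

Lemma shift_chi F : invG F -> shift t (hcup0 chi F) - hcup0 chi F = F.
Proof.
move=> FG; rewrite shift_hcup0 //; apply/funext => -[|x v].
  by rewrite funBE subr0 FG.1.
by rewrite funBE /= chit1 mulrDl mul1r addrAC subrr add0r.
Qed.

Lemma shift_hcup1_eps F : invG F -> hdiff F = 0 ->
  shift t (hcup1 eps F) - hcup1 eps F = hdiff (hcup0 delta F).
Proof.
move=> FG dF; rewrite shift_hcup1 // hdiff_hcup0 //.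
apply/funext => -[|x [|y v]]; rewrite funBE /= ?subrr //.
by rewrite -mulrBl shift_eps.
Qed.

Lemma trace_shiftB F : trace (shift t F - F) = 0.
Proof. by rewrite traceB trace_shift subrr. Qed.

(* Write [F = d K] with [K] invariant under [W] and correct [K] until [t] fixes
   it. The cocycle [(t - 1) K] is cohomologous to its retraction [w], and
   subtracting [chi . w] makes [(t - 1) K] a coboundary [d k]; subtracting
   [eps . v] with [v = trace k] then makes [k] traceless, hence of the form
   [(t - 1) l].                                                                *)
Lemma split_kernel F K : invG F -> hdiff F = 0 -> invW K -> F = hdiff K ->
  exists w v K' : seq G -> 'F_p, [/\ [/\ invG w, hdiff w = 0 & hpull rho w = w],
    invG v /\ hdiff v = 0, invG K' & F = hcup1 dchi w + hcup2 carry3 v + hdiff K'].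
Proof.
move=> FG dF KW FK; pose h := shift t K - K.
have hW : invW h by apply: invB; first exact: inv_shift.
have dh : hdiff h = 0 by rewrite hdiffB hdiff_shift -FK FG.2 ?subrr.
pose w := hpull rho h; pose k := - prism rho h.
have wG : invG w := inv_rho hW.
have dw : hdiff w = 0 by rewrite hdiff_hpull dh raddf0.
have kW : invW k by apply/invN/inv_prism.
have hE : h = w + hdiff k.
  rewrite /k raddfN /= -[X in _ - X](addr0 (hdiff _)).
  by have := prismP rho h; rewrite dh [prism rho 0]raddf0 => ->; rewrite subKr.
pose K1 := K - hcup0 chi w.
have K1W : invW K1 by apply: invB => //; apply: inv_chi.
have dK1 : hdiff K1 = F - hcup1 dchi w by rewrite hdiffB hdiff_chi // -FK.
have tK1 : shift t K1 - K1 = hdiff k.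
  have E := shift_chi wG; apply/funext => u; have {E} := congr1 (@^~ u) E.
  have := congr1 (@^~ u) hE; rewrite /h /K1 !(shiftB, funBE, funDE).
  move=> /eqP; rewrite subr_eq => /eqP -> <-; rewrite !(funNE, funBE); ring.
pose v := trace k.
have vG : invG v := trace_inv kW.
have dv : hdiff v = 0 by rewrite -trace_hdiff -tK1 trace_shiftB.
pose K2 := K1 - hcup1 eps v.
have K2W : invW K2 by apply: invB => //; apply: inv_eps.
have tK2 : shift t K2 - K2 = hdiff (k - hcup0 delta v).
  rewrite hdiffB -shift_hcup1_eps // -tK1 /K2 shiftB.
  by apply/funext => u; rewrite !(funNE, funBE); ring.
have [||l lW tl] := @exact_trace (k - hcup0 delta v).
- by apply: invB => //; apply: inv_delta.
- by rewrite traceB trace_delta // subrr.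
exists w, v, (K2 - hdiff l); split=> //.
- by split=> //; rewrite /w rho_rho.
- apply: invW_t; first by apply: invB => //; apply: inv_hdiff.
  apply/eqP; rewrite -subr_eq0 shiftB -hdiff_shift; apply/eqP.
  have := congr1 (@hdiff _ _) tl; rewrite -tK2 hdiffB => E.
  apply/funext => u; have {E} := congr1 (@^~ u) E; rewrite !funBE.
  by move=> /eqP; rewrite subr_eq => /eqP ->; rewrite -[RHS]/(0 : 'F_p); ring.
rewrite hdiffB hdiff_hdiff subr0 hdiffB dK1 hdiff_eps //.
by apply/funext => u; rewrite !(funBE, funDE, funNE); ring.
Qed.

Lemma shiftB_rho (y : seq G -> 'F_p) : hdiff y = 0 -> invW y ->
  shift t y - y = - hdiff (shift t (prism rho y) - prism rho y).
Proof.
move=> dy yW; have rt := (inv_rho yW).2 t isT; have := prismP rho y.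
rewrite dy [prism rho 0]raddf0 addr0; move: (prism rho y) (hpull rho y) rt => P r rt.
move=> E; have -> : y = r - hdiff P by rewrite E subKr.
rewrite hdiffB hdiff_shift shiftB rt.
by apply/funext => u; rewrite !(funBE, funNE); ring.
Qed.

Section Injectivity.
Variables w v g : seq G -> 'F_p.
Hypotheses (wG : invG w) (vG : invG v) (gG : invG g).
Hypotheses (dw : hdiff w = 0) (dv : hdiff v = 0).
Hypothesis rw : hpull rho w = w.
Hypothesis E : hcup1 dchi w + hcup2 carry3 v = hdiff g.

Let y := g - hcup0 chi w - hcup1 eps v.
Let q := shift t (prism rho y) - prism rho y - hcup0 delta v.

Let yW : invW y.
Proof.
apply: invB; last exact: inv_eps.
by apply: invB; [exact: invGW | exact: inv_chi].
Qed.

Let dy : hdiff y = 0.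
Proof. by rewrite !hdiffB hdiff_chi // hdiff_eps // -E addrAC addrK subrr. Qed.

Let qW : invW q.
Proof.
apply: invB; last exact: inv_delta.
by apply: invB; [apply: inv_shift|]; apply: inv_prism.
Qed.

Let dq : hdiff q = w.
Proof.
rewrite hdiffB -[hdiff (_ - _)]opprK -(shiftB_rho dy yW) -shift_hcup1_eps //.
rewrite -[RHS](shift_chi wG) /y !shiftB gG.2 //.
by apply/funext => u; rewrite !(funBE, funNE); ring.
Qed.

Lemma split_inj1 : exists c, [/\ invG c, hpull rho c = c & w = hdiff c].
Proof.
exists (hpull rho q); split; [exact: inv_rho | by rewrite rho_rho |].
by rewrite hdiff_hpull dq rw.
Qed.

Lemma split_inj2 : w = 0 -> exists2 c, invG c & v = hdiff c.
Proof.
move=> w0; exists (trace (prism rho q)); first exact/trace_inv/inv_prism.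
have := congr1 trace (prismP rho q); rewrite dq w0 raddf0 addr0 -trace_hdiff => ->.
rewrite traceB trace_invG; last exact: inv_rho.
by rewrite sub0r traceB trace_delta // trace_shiftB sub0r opprK.
Qed.
End Injectivity.
End HomogeneousSplit.

Section Homogenization.
Import GRing.Theory.
Local Open Scope ring_scope.
Variables (R : comNzRingType) (G : finGroupType).
Implicit Types (f : seq G -> R) (x y z g : G).

Fixpoint steps x (v : seq G) : seq G :=
  if v is y :: w then (x^-1 * y)%g :: steps y w else [::].

Fixpoint walk x (v : seq G) : seq G :=
  x :: if v is y :: w then walk (x * y)%g w else [::].

Definition homog f (v : seq G) : R := if v is x :: w then f (steps x w) else 0.
Definition inhomog (F : seq G -> R) (v : seq G) : R := F (walk 1%g v).

Lemma size_steps x v : size (steps x v) = size v.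
Proof. by elim: v x => //= y v IHv x; rewrite IHv. Qed.

Lemma steps_walk g v : steps g (behead (walk g v)) = v.
Proof.
elim: v g => [|y v IHv] g //=.
by case: v IHv => [|z v] IHv; rewrite /= mulKg // -[in RHS](IHv (g * y)%g).
Qed.

Lemma homogK f : inhomog (homog f) = f.
Proof.
apply/funext => v; rewrite /inhomog -[in RHS](steps_walk 1%g v).
by case: v.
Qed.

Lemma walk_steps g x v : walk g (steps x v) = map (fun y => g * x^-1 * y)%g (x :: v).
Proof.
elim: v g x => [|y v IHv] g x /=; first by rewrite mulgKV.
by rewrite IHv /= !mulgA !mulgKV mulgK.
Qed.

Lemma inhomogK F : invariant_by xpredT F -> homog (inhomog F) = F.
Proof.
case=> Fn FG; apply/funext => -[|x v]; first by rewrite Fn.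
by rewrite /homog /inhomog walk_steps -[RHS](congr1 (@^~ _) (FG (1 * x^-1)%g isT)).
Qed.

Lemma inv_homog f : invariant_by xpredT (homog f).
Proof.
split=> // g _; apply/funext => -[|x v] //=; congr f.
by elim: v x => //= y v IHv x; rewrite IHv invMg mulgA mulgKV.
Qed.

Definition del i (v : seq G) := take i v ++ drop i.+1 v.

Lemma hdiffE (F : seq G -> R) v : hdiff F v = \sum_(i < size v) (-1) ^+ i * F (del i v).
Proof.
elim: v F => [|x v IHv] F /=; first by rewrite big_ord0.
rewrite big_ord_recl mul1r {1}/del /= drop0 IHv -sumrN; congr (_ + _).
by apply: eq_bigr => i _; rewrite /bump leq0n add1n exprS mulN1r mulNr.
Qed.

Lemma face_steps x j v : (j < size v)%N -> face j.+1 (steps x v) = steps x (del j v).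
Proof.
elim: v x j => [|y v IHv] x [|j] //; rewrite /del.
  by case: v {IHv} => [|z v] //= _; rewrite face1 mulgA mulgK.
by case: v IHv => [|z v] // IHv lt_jv; rewrite faceS [LHS]/= IHv.
Qed.

Lemma homog_diff f : homog (diff f) = hdiff (homog f).
Proof.
apply/funext => -[|x [|y v]] //=; first by rewrite subr0.
rewrite -[RHS]/(hdiff (homog f) [:: x, y & v]) hdiffE size_steps.
apply: eq_bigr => -[[|i] /= lti] _; congr (_ * _); rewrite /del.

rewrite -[_ :: steps y v]/(steps x (y :: v)) face_steps //.
Qed.

Lemma cup_homogeneous m f (h : seq G -> R) v : (forall w, size w != m -> f w = 0) ->
  cup f h v = if (m <= size v)%N then f (take m v) * h (drop m v) else 0.
Proof.
move=> f_m; rewrite /cup; case: leqP => [le_mv|lt_vm]; last first.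
  apply: big1 => i _; rewrite f_m ?mul0r // neq_ltn.
  by rewrite (leq_ltn_trans _ lt_vm) // size_take_min geq_minr.
have lt_mv : (m < (size v).+1)%N by [].
rewrite (bigD1 (Ordinal lt_mv)) //= big1 ?addr0 // => i i_m.
by rewrite f_m ?mul0r // size_takel // -ltnS.
Qed.

Lemma homog_cup1 f (h : seq G -> R) : (forall v, size v != 1%N -> f v = 0) ->
  homog (cup f h) = hcup1 (fun x y => f [:: x^-1 * y]%g) (homog h).
Proof.
move=> f1; apply/funext => -[|x [|y v]] //; rewrite /homog (cup_homogeneous _ _ f1) //.
by rewrite /= take0 drop0.
Qed.

Lemma homog_cup2 f (h : seq G -> R) : (forall v, size v != 2%N -> f v = 0) ->
  homog (cup f h) = hcup2 (fun x y z => f [:: x^-1 * y; y^-1 * z]%g) (homog h).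
Proof.
move=> f2; apply/funext => -[|x [|y [|z v]]] //;
  rewrite /homog (cup_homogeneous _ _ f2) //.
by rewrite /= take0 drop0.
Qed.

Lemma diff1 f x : diff f [:: x] = 0.
Proof. by rewrite /diff !big_ord_recl big_ord0 mul1r addr0 expr1 mulN1r subrr. Qed.

Lemma diff2 f x y : diff f [:: x; y] = f [:: y] - f [:: (x * y)%g] + f [:: x].
Proof.
rewrite /diff !big_ord_recl big_ord0 mul1r addr0 expr1 mulN1r -signr_odd mul1r.
by rewrite addrA.
Qed.

Lemma homogD f1 f2 : homog (f1 + f2) = homog f1 + homog f2.
Proof. by apply/funext => -[|x v] //; rewrite funDE addr0. Qed.

Lemma homog_inj : injective homog.
Proof. exact: can_inj homogK. Qed.

End Homogenization.

Section HomogenizationPullback.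
Import GRing.Theory.
Local Open Scope ring_scope.

Lemma homog_hpull (R : comNzRingType) (K G : finGroupType) (phi : K -> G) (f : seq G -> R) :
  {morph phi : x y / (x * y)%g} ->
  hpull phi (homog f) = homog (fun v : seq K => f (map phi v)).
Proof.
move=> phiM; have phi1 : phi 1%g = 1%g by apply: (mulgI (phi 1%g)); rewrite -phiM !mulg1.
have phiV x : phi x^-1%g = (phi x)^-1%g by apply: (mulgI (phi x)); rewrite -phiM !mulgV.
apply/funext => -[|x v] //=; congr f.
by elim: v x => //= y v IHv x; rewrite IHv phiM phiV.
Qed.

End HomogenizationPullback.

Section Truncation.
Import GRing.Theory.
Local Open Scope ring_scope.
Variables (R : comNzRingType) (G : finGroupType).
Implicit Types (f : seq G -> R) (v : seq G) (z : cocycle R G).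

Definition truncate N f v : R := if (size v < N)%N then f v else 0.

Lemma bounded_truncate N f : bounded (truncate N f).
Proof.
by apply/asboolP; exists N => v ltNv; rewrite /truncate ltnNge (ltnW ltNv).
Qed.

Definition truncation N f : cochain R G := Cochain (bounded_truncate N f).

Lemma diff_truncate N f v :
  diff (truncate N f) v = if (size v < N.+1)%N then diff f v else 0.
Proof.
have [/size0nil->//|v_gt0] := posnP (size v).
have szf (i : 'I_(size v).+1) : (size (face i v) < N)%N = (size v < N.+1)%N.
  have le_i : (i <= size v)%N := ltn_ord i.
  by rewrite (size_face le_i) -[in RHS](prednK v_gt0).
rewrite !diffE //; case: ifP => lt_vN.
  by apply: eq_bigr => i _; rewrite /truncate szf lt_vN.
by apply: big1 => i _; rewrite /truncate szf lt_vN mulr0.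
Qed.

Lemma cocycle_truncation f N :
  diff f = 0 -> cocycle_pred (truncation N f).
Proof.
move=> df; apply/eqP/cochain_eq => w; rewrite [LHS]diff_truncate df.
by case: ifP.
Qed.

Lemma cup_truncate m f g N v : (forall w, size w != m -> f w = 0) ->
  cup f (truncate N g) v = if (size v < N + m)%N then cup f g v else 0.
Proof.
move=> fm; rewrite !(cup_homogeneous _ _ fm) /truncate size_drop.
case: (leqP m (size v)) => [le_mv|_]; last by rewrite if_same.
by rewrite -(ltn_add2r m) subnK //; case: ifP; rewrite ?mulr0.
Qed.

Definition degree_lt N (u : cohomology R G) :=
  exists2 z : cocycle R G, (forall w, (N <= size w)%N -> z w = 0) & u = coh_class z.

Lemma coh_classM z1 z2 : coh_class (z1 * z2) = coh_class z1 * coh_class z2.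
Proof. by rewrite rmorphM. Qed.

Lemma coh_classD z1 z2 : coh_class (z1 + z2) = coh_class z1 + coh_class z2.
Proof. by rewrite raddfD. Qed.

Lemma coh_class0P z : coh_class z = 0 <-> exists c, coboundary c = cocycle_val z.
Proof.
rewrite -[0](raddf0 (@coh_class R G)); split=> [/classP|] [c dc].
  by exists c; rewrite dc; apply: subr0.
by apply/classP; exists c; rewrite dc; apply/esym/subr0.
Qed.

Lemma degree_ltP u : exists N, degree_lt N u.
Proof.
elim/class_ind: u => z; have [N zN] := cochain_bounded z.
by exists N.+1, z.
Qed.

Lemma degree_ltB N (u v : cohomology R G) : degree_lt N u -> degree_lt N v -> degree_lt N (u - v).
Proof.
move=> [z1 z1N ->] [z2 z2N ->]; exists (z1 - z2); last by rewrite raddfB.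
by move=> w Nw; rewrite -[LHS]/(z1 w - z2 w) z1N ?z2N // subrr.
Qed.

Lemma degree_lt0 u : degree_lt 0 u -> u = 0.
Proof.
case=> z z0 ->; rewrite (_ : z = 0) ?raddf0 //.
by apply/val_inj/cochain_eq => w; rewrite z0.
Qed.

Lemma degree_ltW M N u : (M <= N)%N -> degree_lt M u -> degree_lt N u.
Proof. by move=> MN [z zM ->]; exists z => // w Nw; apply/zM/leq_trans/Nw. Qed.

Lemma class_diff_eq0 z f : (z : seq G -> R) = diff f -> coh_class z = 0.
Proof.
move=> zf; have [N zN] := cochain_bounded z.
rewrite -(raddf0 (@coh_class R G)); apply/classP; exists (truncation N f).
apply: cochain_eq => w; rewrite [LHS]diff_truncate cochainBE /= subr0 -zf.
by case: ltnP => // /zN.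
Qed.

Lemma cocycle_hdiff z : hdiff (homog z) = 0.
Proof.
rewrite -homog_diff; apply/funext => -[|x v] //=.
by rewrite -[diff z]/(cochain_val (coboundary z)) coboundary_cocycle.
Qed.

Lemma hdiff_cocycle f : hdiff (homog f) = 0 -> diff f = 0.
Proof. by rewrite -homog_diff => df; apply: homog_inj; rewrite df; apply/funext => -[]. Qed.

End Truncation.

Section Pullback.
Import GRing.Theory.
Local Open Scope ring_scope.
Variables (R : comNzRingType) (K G : finGroupType) (phi : K -> G).
Hypothesis phiM : {morph phi : x y / (x * y)%g}.
Implicit Types (c : cochain R G) (z : cocycle R G) (u v : cohomology R G).

Lemma bounded_pull c : bounded (fun v : seq K => c (map phi v)).
Proof.
have [N cN] := cochain_bounded c.
by apply/asboolP; exists N => w Nw; apply: cN; rewrite size_map.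
Qed.

Definition cochain_pull c : cochain R K := Cochain (bounded_pull c).

Lemma diff_pull (f : seq G -> R) :
  diff (fun v : seq K => f (map phi v)) = fun v : seq K => diff f (map phi v).
Proof.
by apply: homog_inj; rewrite homog_diff -!homog_hpull // hdiff_hpull homog_diff.
Qed.

Lemma coboundary_pull c : coboundary (cochain_pull c) = cochain_pull (coboundary c).
Proof. by apply: cochain_eq => v; rewrite /= diff_pull. Qed.

Lemma cocycle_pull_subproof z : cocycle_pred (cochain_pull z).
Proof.
apply/eqP; rewrite coboundary_pull coboundary_cocycle.
exact: cochain_eq.
Qed.

Definition cocycle_pull z : cocycle R K := Cocycle (cocycle_pull_subproof z).

Definition pull u : cohomology R K := locked (coh_class (cocycle_pull (repr u))).

Lemma pull_class z : pull (coh_class z) = coh_class (cocycle_pull z).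
Proof.
rewrite /pull -lock; have /classP[c dc] := class_repr (coh_class z); apply/classP.
exists (cochain_pull c); rewrite coboundary_pull dc.
exact: cochain_eq.
Qed.

Lemma pullB u v : pull (u - v) = pull u - pull v.
Proof.
elim/class_ind: u => z1; elim/class_ind: v => z2.
rewrite -raddfB /= !pull_class -raddfB /=; congr coh_class.
exact/val_inj/cochain_eq.
Qed.

Lemma pull0 : pull 0 = 0. Proof. by rewrite -[0](subrr 0) pullB subrr. Qed.
Lemma pullN u : pull (- u) = - pull u.
Proof. by rewrite -sub0r pullB pull0 sub0r. Qed.
Lemma pullD u v : pull (u + v) = pull u + pull v.
Proof. by rewrite -{1}[v]opprK pullB pullN opprK. Qed.

Lemma pull1 : pull 1 = 1.
Proof.
rewrite -[1 in LHS]/(coh_class 1) pull_class; congr coh_class.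
by apply/val_inj/cochain_eq => -[].
Qed.

Lemma pullM u v : pull (u * v) = pull u * pull v.
Proof.
elim/class_ind: u => z1; elim/class_ind: v => z2.
rewrite -rmorphM /= !pull_class -rmorphM /=; congr coh_class.
apply/val_inj/cochain_eq => w /=; rewrite /cup size_map; apply: eq_bigr => k _.
by rewrite map_take map_drop.
Qed.

Lemma degree_pull N u : degree_lt N u -> degree_lt N (pull u).
Proof.
case=> z zN ->; rewrite pull_class; exists (cocycle_pull z) => // w Nw.
by rewrite /= zN // size_map.
Qed.

End Pullback.

Section PullbackComp.
Import GRing.Theory.
Local Open Scope ring_scope.
Variables (R : comNzRingType).

Lemma pull_comp (K G H : finGroupType) (phi : K -> G) (psi : G -> H) (chi : K -> H)
    (phiM : {morph phi : x y / (x * y)%g}) (psiM : {morph psi : x y / (x * y)%g})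
    (chiM : {morph chi : x y / (x * y)%g}) (u : cohomology R H) :
  psi \o phi =1 chi -> pull phiM (pull psiM u) = pull chiM u.
Proof.
move=> E; elim/class_ind: u => z; rewrite !pull_class; congr coh_class.
by apply/val_inj/cochain_eq => w; rewrite /= -map_comp (eq_map E).
Qed.

Lemma pull_id (G : finGroupType) (phi : G -> G)
    (phiM : {morph phi : x y / (x * y)%g}) (u : cohomology R G) :
  phi =1 id -> pull phiM u = u.
Proof.
move=> E; elim/class_ind: u => z; rewrite pull_class; congr coh_class.
by apply/val_inj/cochain_eq => w; rewrite /= (eq_map E) map_id.
Qed.

Lemma restrictionE (G : finGroupType) (W : {group G})
    (sgvalM : {morph @sgval G W : x y / (x * y)%g}) (u : cohomology R G) :
  restriction W u = pull sgvalM u.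
Proof.
elim/class_ind: u => z; rewrite restriction_class pull_class; congr coh_class.
exact/val_inj/cochain_eq.
Qed.

End PullbackComp.

Section BocksteinPull.
Import GRing.Theory.
Local Open Scope ring_scope.
Variables (p : nat) (p_pr : prime p).

Lemma bockstein_data (G : finGroupType) (z : cocycle 'F_p G) :
  exists (c b : cochain int G) (z' : cocycle 'F_p G),
    [/\ reduce_cochain p c = z, coboundary c = b *+ p, reduce_cochain p b = z'
      & forall w, z w = 0 -> c w = 0].
Proof.
pose c := lift_cochain z.
have cz : reduce_cochain p c = z by apply: lift_cochainK.
have /(reduce_eq0 p_pr) dc : reduce_cochain p (coboundary c) = 0.
  by rewrite -coboundary_reduce cz coboundary_cocycle.
pose b := divide_cochain p (coboundary c).
suff bP : cocycle_pred (reduce_cochain p b).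
  by exists c, b, (Cocycle bP); split=> // w; rewrite /= => ->.
apply/eqP; rewrite coboundary_reduce.
have : coboundary b *+ p = 0 by rewrite -raddfMn /= -dc coboundaryK.
move=> db0; rewrite -(divide_cochainK p_pr (coboundary b)) db0.
by apply: cochain_eq => w; rewrite /= div0z.
Qed.

Lemma bockstein_pull (K G : finGroupType) (phi : K -> G)
    (phiM : {morph phi : x y / (x * y)%g}) (u : cohomology 'F_p G) :
  bockstein (pull phiM u) = pull phiM (bockstein u).
Proof.
elim/class_ind: u => z; have [c [b [z' [cz dc bz' _]]]] := bockstein_data z.
rewrite (bockstein_class p_pr cz dc bz') !pull_class.
apply: (bockstein_class p_pr (c := cochain_pull phi c) (b := cochain_pull phi b)).
- by rewrite /= -cz; apply: cochain_eq.
- by rewrite coboundary_pull // dc; apply: cochain_eq => w; rewrite /= !cochainMnE.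
- by rewrite /= -bz'; apply: cochain_eq.
Qed.

Lemma bocksteinB (G : finGroupType) (u v : cohomology 'F_p G) :
  bockstein (u - v) = bockstein u - bockstein v.
Proof.
elim/class_ind: u => z1; have [c1 [b1 [z1' [cz1 dc1 bz1 _]]]] := bockstein_data z1.
elim/class_ind: v => z2; have [c2 [b2 [z2' [cz2 dc2 bz2 _]]]] := bockstein_data z2.
rewrite (bockstein_class p_pr cz1 dc1 bz1) (bockstein_class p_pr cz2 dc2 bz2).
rewrite -!raddfB /=; apply: (bockstein_class p_pr (c := c1 - c2) (b := b1 - b2)).
- by rewrite reduceB cz1 cz2.
- by rewrite raddfB /= dc1 dc2 mulrnBl.
- by rewrite reduceB bz1 bz2.
Qed.

Lemma bocksteinD (G : finGroupType) (u v : cohomology 'F_p G) :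
  bockstein (u + v) = bockstein u + bockstein v.
Proof.
have b0 : bockstein (0 : cohomology 'F_p G) = 0.
  by rewrite -[X in bockstein X](subrr 0) bocksteinB subrr.
have bN : bockstein (- v) = - bockstein v by rewrite -[- v]add0r bocksteinB b0 sub0r.
by rewrite -[in LHS](opprK v) bocksteinB bN opprK.
Qed.

Lemma bockstein_bockstein (G : finGroupType) (u : cohomology 'F_p G) :
  bockstein (bockstein u) = 0.
Proof.
elim/class_ind: u => z; have [c [b [z' [cz dc bz' _]]]] := bockstein_data z.
rewrite (bockstein_class p_pr cz dc bz').
rewrite (bockstein_class p_pr (c := b) (b := 0) (z' := 0)) ?raddf0 //.
- rewrite -[LHS](divide_cochainK p_pr) -raddfMn /= -dc coboundaryK mul0rn.
  by apply: cochain_eq => w; rewrite /= div0z.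
- exact: cochain_eq.
Qed.

Lemma reduceM (G : finGroupType) (c1 c2 : cochain int G) :
  reduce_cochain p (c1 * c2) = reduce_cochain p c1 * reduce_cochain p c2.
Proof.
apply: cochain_eq => w; rewrite /= /cup rmorph_sum.
by apply: eq_bigr => k _; rewrite rmorphM.
Qed.

Lemma alternate_homogeneous (R : comNzRingType) (G : finGroupType)
    (c : cochain R G) m : homogeneous m c -> alternate c = (-1) ^+ m * c.
Proof.
move=> cm; have E k w : ((-1) ^+ k * c) w = (-1) ^+ k * c w.
  elim: k => [|k IHk]; first by rewrite !mul1r.
  by rewrite !exprS -!mulrA !mulN1r cochainNE IHk.
apply: cochain_eq => w; rewrite E /= /alt_sign.
by have [->//|/cm->] := eqVneq (size w) m; rewrite !mulr0.
Qed.

Lemma bocksteinM (G : finGroupType) (z : cocycle 'F_p G) (u : cohomology 'F_p G) m :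
  homogeneous m z ->
  bockstein (coh_class z * u) =
    bockstein (coh_class z) * u + (-1) ^+ m * (coh_class z * bockstein u).
Proof.
move=> zm; have [c1 [b1 [z1 [cz1 dc1 bz1 c1z]]]] := bockstein_data z.
elim/class_ind: u => z2; have [c2 [b2 [z2' [cz2 dc2 bz2 _]]]] := bockstein_data z2.
rewrite (bockstein_class p_pr cz1 dc1 bz1) (bockstein_class p_pr cz2 dc2 bz2).
have -> : (-1) ^+ m = coh_class ((-1) ^+ m) :> cohomology 'F_p G.
  by rewrite rmorphXn rmorphN1.
rewrite -(coh_classM z z2') -(coh_classM z1 z2) -(coh_classM z z2).
rewrite -(coh_classM ((-1) ^+ m)) -raddfD /=.
apply: (bockstein_class p_pr (c := c1 * c2) (b := b1 * c2 + (-1) ^+ m * (c1 * b2))).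
- by rewrite reduceM cz1 cz2.
- rewrite coboundaryM dc1 dc2 (@alternate_homogeneous _ _ _ m).
    by rewrite mulrnDl mulrnAl mulrnAr mulrA.
  by move=> w /zm/c1z.
- rewrite reduceD !reduceM bz1 cz2 cz1 bz2; congr (_ + _ * _).
  rewrite -[RHS]/(val ((-1) ^+ m : cocycle 'F_p G)).
  have E : reduce_cochain p (-1 : cochain int G) = -1.
    apply: cochain_eq => w; rewrite [RHS]cochainNE.
    rewrite -[LHS]/((- cup_unit int w)%:~R : 'F_p) rmorphN; congr (- _).
    by rewrite -[RHS]/(cup_unit _ w) /cup_unit; case: (w == [::]).
  elim: m {zm} => [|k IHk]; last by rewrite !exprS reduceM IHk E.
  apply: cochain_eq => w; rewrite -[RHS]/(cup_unit _ w).
  by rewrite -[LHS]/((cup_unit int w)%:~R : 'F_p) /cup_unit; case: (w == [::]).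
Qed.
End BocksteinPull.

Section Dual.
Import GRing.Theory.
Local Open Scope ring_scope.
Variables (p : nat) (G : finGroupType).

Definition additive_char : {pred {ffun G -> 'F_p}} :=
  fun f => [forall x, forall y, f (x * y)%g == f x + f y].

Lemma additive_charP (f : {ffun G -> 'F_p}) :
  reflect (forall x y, f (x * y)%g = f x + f y) (f \in additive_char).
Proof.
apply: (iffP forallP) => [fM x y|fM x]; first by have /forallP/(_ y)/eqP := fM x.
by apply/forallP => y; apply/eqP.
Qed.

Lemma additive_char_zmod_closed : zmod_closed additive_char.
Proof.
split=> [|f g /additive_charP fM /additive_charP gM]; apply/additive_charP => x y.
  by rewrite !ffunE addr0.
by rewrite !ffunE fM gM opprD addrACA.
Qed.
HB.instance Definition _ := GRing.isZmodClosed.Build {ffun G -> 'F_p}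
  additive_char additive_char_zmod_closed.

Record dual := Dual { dual_val :> {ffun G -> 'F_p}; dualP : additive_char dual_val }.
HB.instance Definition _ := [isSub for dual_val].
HB.instance Definition _ := [Finite of dual by <:].
HB.instance Definition _ := [SubChoice_isSubZmodule of dual by <:].

Implicit Types (b : dual) (x y : G).

Lemma dualM b x y : b (x * y)%g = b x + b y.
Proof. exact: (additive_charP _ (dualP b)). Qed.

Lemma dual_eq b1 b2 : (forall x, b1 x = b2 x) -> b1 = b2.
Proof. by move=> E; apply/val_inj/ffunP. Qed.

Lemma dualBE b1 b2 x : (b1 - b2) x = b1 x - b2 x.
Proof. by rewrite -[LHS]/((dual_val b1 - dual_val b2) x) !ffunE. Qed.
Lemma dual0E x : (0 : dual) x = 0. Proof. by rewrite -[LHS]/((0 : {ffun _}) x) ffunE. Qed.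
Lemma dualNE b x : (- b) x = - b x.
Proof. by rewrite -sub0r dualBE dual0E sub0r. Qed.
Lemma dualDE b1 b2 x : (b1 + b2) x = b1 x + b2 x.
Proof. by rewrite -{1}[b2]opprK dualBE dualNE opprK. Qed.
Lemma dualMnE b k x : (b *+ k) x = b x *+ k.
Proof. by elim: k => [|k IHk]; rewrite ?dual0E // !mulrS dualDE IHk. Qed.

Lemma dual1 b : b 1%g = 0.
Proof. by apply: (@addrI _ (b 1%g)); rewrite -dualM mulg1 addr0. Qed.

Lemma dualV b x : b x^-1%g = - b x.
Proof. by apply: (@addrI _ (b x)); rewrite -dualM mulgV dual1 subrr. Qed.

Lemma dualX b x k : b (x ^+ k)%g = b x *+ k.
Proof. by elim: k => [|k IHk]; rewrite ?dual1 // expgS dualM IHk mulrS. Qed.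

Definition char_fun b (v : seq G) : 'F_p := if v is [:: x] then b x else 0.

Lemma bounded_char b : bounded (char_fun b).
Proof. by apply/asboolP; exists 1%N => -[|x [|y v]]. Qed.

Definition char_cochain b : cochain 'F_p G := Cochain (bounded_char b).

Lemma homog_char_cup b (f : seq G -> 'F_p) :
  homog (cup (char_fun b) f) = hcup1 (fun x y => b y - b x) (homog f).
Proof.
rewrite homog_cup1 => [|[|x [|y v]]] //.
by apply/funext => -[|x [|y v]] //=; rewrite dualM dualV [- _ + _]addrC.
Qed.

Let unit_cocycle : hdiff (homog (@cup_unit 'F_p G)) = 0.
Proof. exact: (cocycle_hdiff (1 : cocycle 'F_p G)). Qed.

Lemma cocycle_char_subproof b : cocycle_pred (char_cochain b).
Proof.
apply/eqP/cochain_eq => w.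
rewrite -[LHS]/(diff (char_fun b) w) hdiff_cocycle //.
have -> : char_fun b = cup (char_fun b) (@cup_unit _ G) by apply/funext => v; rewrite cup1r.
by rewrite homog_char_cup -hdiff_hcup0 ?hdiff_hdiff.
Qed.

Definition char_cocycle b : cocycle 'F_p G := Cocycle (cocycle_char_subproof b).

Definition cl b : cohomology 'F_p G := locked (coh_class (char_cocycle b)).

Lemma clE b : cl b = coh_class (char_cocycle b). Proof. by rewrite /cl -lock. Qed.

Lemma homogeneous_char b : homogeneous 1 (char_cocycle b).
Proof. by case=> [|x [|y v]]. Qed.

Lemma clB b1 b2 : cl (b1 - b2) = cl b1 - cl b2.
Proof.
rewrite !clE -raddfB /=; congr coh_class; apply/val_inj/cochain_eq => w.
rewrite -[LHS]/(char_fun (b1 - b2) w) -[RHS]/(char_fun b1 w - char_fun b2 w).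
by case: w => [|x [|y v]]; rewrite /= ?subr0 ?dualBE.
Qed.

Lemma degree1_cl u : coh_degree 1 u -> exists b, u = cl b.
Proof.
case=> z z1 ->; have fM : [ffun x => z [:: x]] \in additive_char.
  apply/additive_charP => x y; rewrite !ffunE.
  have : diff z [:: x; y] = 0.
    exact: (congr1 (fun c : cochain 'F_p G => c [:: x; y]) (coboundary_cocycle z)).
  by rewrite diff2 addrAC => /eqP; rewrite subr_eq0 addrC => /eqP.
exists (Dual fM); rewrite clE; congr coh_class; apply/val_inj/cochain_eq => -[|x [|y v]] //=.
- by rewrite z1.
- by rewrite ffunE.
- by rewrite z1.
Qed.

Lemma degree1_of_cl b : coh_degree 1 (cl b).
Proof. by exists (char_cocycle b); [exact: homogeneous_char | exact: clE]. Qed.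

End Dual.

Section Chern.
Import GRing.Theory.
Local Open Scope ring_scope.
Variables (p : nat) (p_pr : prime p) (G : finGroupType).
Hypothesis mulGC : forall x y : G, (x * y = y * x)%g.
Implicit Types (b : dual p G) (x y : G).

Let Fp_p : (Zp_trunc (pdiv p)).+2 = p. Proof. exact: Fp_cast. Qed.

Definition chern b := locked (bockstein (cl b)).

Lemma bockstein_cl b : bockstein (cl b) = chern b. Proof. by rewrite /chern -lock. Qed.

Lemma chernB b1 b2 : chern (b1 - b2) = chern b1 - chern b2.
Proof. by rewrite -!bockstein_cl clB bocksteinB. Qed.

Let lt_p (k : 'F_p) : (k < p)%N. Proof. by rewrite -{2}Fp_p. Qed.

Let valD (i j : 'F_p) : (nat_of_ord i + j = nat_of_ord (i + j)%R + p * (p <= i + j))%N.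
Proof.
rewrite -[nat_of_ord (i + j)%R]/((i + j) %% _)%N [X in (_ %% X)%N]Fp_p.
have := lt_p i; have := lt_p j; have p0 := prime_gt0 p_pr.
move: (nat_of_ord i) (nat_of_ord j) => {i j} i j ltj lti.
case: (leqP p (i + j)%N) => [le_p|lt]; last by rewrite modn_small // muln0 addn0.
by rewrite muln1 -{2}(subnK le_p) modnDr modn_small; lia.
Qed.

Definition carry b x y : bool := (p <= b x + b y)%N.

Definition carry_fun (R : comNzRingType) b (v : seq G) : R :=
  if v is [:: x; y] then (carry b x y)%:R else 0.

Lemma bounded_carry R b : bounded (carry_fun R b).
Proof. by apply/asboolP; exists 2%N => -[|x [|y [|z v]]]. Qed.

Lemma homog_carry b (f : seq G -> 'F_p) :
  homog (cup (carry_fun 'F_p b) f) = hcup2 (carry3 b) (homog f).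
Proof.
rewrite homog_cup2 => [|[|x [|y [|z v]]]] //.
apply/funext => -[|x [|y [|z v]]] //=; congr (_ * _).
have E u w : (b (u^-1 * w)%g + b u = b w + p * (b w < b u))%N.
  have := valD (b (u^-1 * w)%g) (b u).
  rewrite -dualM [(_ * u)%g]mulGC mulKVg => ->; congr (_ + p * _)%N.
  have := valD (b (u^-1 * w)%g) (b u); rewrite -dualM [(_ * u)%g]mulGC mulKVg.
  have := lt_p (b u); have := lt_p (b (u^-1 * w)%g); have := lt_p (b w).
  by case: (leqP p (b (u^-1 * w)%g + b u)) => /=; lia.
have D := valD (b (x^-1 * y)%g) (b (y^-1 * z)%g).
rewrite -dualM mulgA mulgK in D.
have {E D} : (carry b (x^-1 * y) (y^-1 * z) + (b z < b x) = (b y < b x) + (b z < b y))%N.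
  rewrite /carry; have p0 := prime_gt0 p_pr.
  have := E x y; have := E y z; have := E x z; move: D.
  move: (nat_of_bool _) (nat_of_bool _) (nat_of_bool _) (nat_of_bool _).
  move: (nat_of_ord _) (nat_of_ord _) (nat_of_ord _) (nat_of_ord _) (nat_of_ord _)
    (nat_of_ord _).
  move=> a1 a2 a3 a4 a5 a6 c1 c2 c3 c4 E1 E2 E3 E4.
  apply/eqP; rewrite -(eqn_pmul2l p0) !mulnDr; apply/eqP.
  by move: (p * c1)%N (p * c2)%N (p * c3)%N (p * c4)%N E1 E2 E3 E4 => ????; lia.
move=> /(congr1 (fun k : nat => k%:R : 'F_p)); rewrite !natrD /carry3 => E.
by rewrite addrAC [X in X - _]addrC -E addrK.
Qed.

Lemma cocycle_carry_subproof b : cocycle_pred (Cochain (bounded_carry 'F_p b)).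
Proof.
apply/eqP/cochain_eq => w; rewrite -[LHS]/(diff (carry_fun 'F_p b) w) hdiff_cocycle //.
have -> : carry_fun 'F_p b = cup (carry_fun 'F_p b) (@cup_unit _ G).
  by apply/funext => v; rewrite cup1r.
rewrite homog_carry /carry3 -hdiff_hcup1 ?hdiff_hdiff //.
exact: (cocycle_hdiff (1 : cocycle 'F_p G)).
Qed.

Definition carry_cocycle b : cocycle 'F_p G := Cocycle (cocycle_carry_subproof b).

Lemma homogeneous_carry b : homogeneous 2 (carry_cocycle b).
Proof. by case=> [|x [|y [|z v]]]. Qed.

Lemma chernE b : chern b = coh_class (carry_cocycle b).
Proof.
rewrite -bockstein_cl clE.
apply: (bockstein_class p_pr (c := lift_cochain (char_cochain b))
  (b := Cochain (bounded_carry int b))).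
- exact: lift_cochainK.
- apply: cochain_eq => w; rewrite cochainMnE -[LHS]/(diff (lift_cochain (char_cochain b)) w).
  case: w => [|x [|y [|z v]]]; first by rewrite mul0rn.
  + by rewrite diff1 mul0rn.
  + rewrite diff2 -[LHS]/((b y : nat)%:Z - (b (x * y)%g : nat)%:Z + (b x : nat)%:Z).
    rewrite addrAC -PoszD addnC valD -dualM PoszD addrAC subrr add0r /= /carry.
    by case: (p <= _)%N; rewrite ?muln1 ?muln0 ?mul0rn // [RHS]natz.
  + rewrite mul0rn diffE // big1 // => i _.
    have le_i : (i <= size [:: x, y, z & v])%N := ltn_ord i.
    have : size (face i [:: x, y, z & v]) = (size v).+2 by rewrite (size_face le_i).
    by case: (face i _) => [|? [|? [|]]] //= _; rewrite mulr0.
- apply: cochain_eq => -[|x [|y [|z v]]] //=.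
  by case: (carry _ _ _).
Qed.

Lemma bockstein_chern b : bockstein (chern b) = 0.
Proof. by rewrite -bockstein_cl; apply: bockstein_bockstein. Qed.

Lemma bockstein_cl_mul b u : bockstein (cl b * u) = chern b * u - cl b * bockstein u.
Proof.
by rewrite clE (bocksteinM p_pr _ (homogeneous_char b)) expr1 mulN1r -clE bockstein_cl.
Qed.

Lemma bockstein_chern_mul b u : bockstein (chern b * u) = chern b * bockstein u.
Proof.
rewrite chernE (bocksteinM p_pr _ (homogeneous_carry b)) -chernE bockstein_chern.
by rewrite -signr_odd mul1r mul0r add0r.
Qed.

End Chern.

Section CharPull.
Import GRing.Theory.
Local Open Scope ring_scope.
Variables (p : nat) (p_pr : prime p) (K G : finGroupType) (phi : K -> G).
Hypothesis phiM : {morph phi : x y / (x * y)%g}.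

Lemma dual_pull_subproof (b : dual p G) : additive_char [ffun x => b (phi x)].
Proof. by apply/additive_charP => x y; rewrite !ffunE phiM dualM. Qed.

Definition dual_pull (b : dual p G) : dual p K := Dual (dual_pull_subproof b).

Lemma dual_pullE b x : dual_pull b x = b (phi x).
Proof. by rewrite /= ffunE. Qed.

Lemma pull_cl b : pull phiM (cl b) = cl (dual_pull b).
Proof.
rewrite !clE pull_class; congr coh_class; apply/val_inj/cochain_eq.
by move=> -[|x [|y v]] //=; rewrite ffunE.
Qed.

Lemma pull_chern b : pull phiM (chern b) = chern (dual_pull b).
Proof. by rewrite -!bockstein_cl -bockstein_pull // pull_cl. Qed.
End CharPull.

Section Splitting.
Import GRing.Theory.
Local Open Scope ring_scope.
Variables (p : nat) (p_pr : prime p) (G : finGroupType).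
Hypothesis mulGC : forall x y : G, (x * y = y * x)%g.
Hypothesis expG : forall x : G, (x ^+ p = 1)%g.
Variables (b : dual p G) (t : G).
Hypothesis bt : b t = 1.

Let bT k : b (t ^+ k)%g = k%:R. Proof. by rewrite dualX bt. Qed.

Lemma char_ker_group_set : group_set [set x | b x == 0].
Proof.
apply/group_setP; split=> [|x y]; rewrite !inE ?dual1 //.
by rewrite dualM => /eqP-> /eqP->; rewrite addr0.
Qed.
Canonical char_ker := Group char_ker_group_set.

Local Notation K := (subg_of char_ker).

Definition char_retract (x : G) : G := (x * t ^- (b x))%g.
Definition char_proj x : K := subg char_ker (char_retract x).

Lemma char_incl_morph : {morph @sgval G char_ker : x y / (x * y)%g}.
Proof. by []. Qed.

Lemma char_sgval (k : K) : b (sgval k) = 0.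
Proof. by have := subgP k; rewrite inE => /eqP. Qed.

Lemma char_retract_ker x : b (char_retract x) = 0.
Proof. by rewrite dualM dualV bT natr_Zp subrr. Qed.

Lemma char_projE x : sgval (char_proj x) = char_retract x.
Proof. by rewrite subgK // inE char_retract_ker. Qed.

Lemma char_projK k : char_proj (sgval k) = k.
Proof. by apply: val_inj; rewrite /= char_projE /char_retract char_sgval invg1 mulg1. Qed.

Let Fp_p : (Zp_trunc (pdiv p)).+2 = p. Proof. exact: Fp_cast. Qed.

Lemma char_proj_morph : {morph char_proj : x y / (x * y)%g}.
Proof.
move=> x y; apply: val_inj; rewrite -[LHS]/(sgval (char_proj _)).
rewrite -[RHS]/(sgval (char_proj x) * sgval (char_proj y))%g !char_projE /char_retract dualM.
have -> : (t ^+ (b x + b y)%R = t ^+ b x * t ^+ b y)%g.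
  by rewrite /= [X in (_ %% X)%N]Fp_p expg_mod // expgD.
by rewrite invMg -!mulgA; congr (_ * _)%g; rewrite mulgA mulGC.
Qed.

Local Notation res := (@pull 'F_p _ _ _ char_incl_morph).
Local Notation inf := (@pull 'F_p _ _ _ char_proj_morph).

Lemma pull_inclK u : res (inf u) = u.
Proof.
have idM : {morph (fun k : K => k) : x y / (x * y)%g} by [].
by rewrite (pull_comp char_incl_morph char_proj_morph idM) ?pull_id //; apply: char_projK.
Qed.

Let hpull_retract (F : seq G -> 'F_p) :
  hpull char_retract F = hpull char_proj (hpull (@sgval G char_ker) F).
Proof.
apply/funext => v; rewrite /hpull -map_comp; congr (F _).
by apply: eq_map => x; rewrite /= char_projE.
Qed.

Lemma restriction_eq0 u N : degree_lt N.+2 u -> res u = 0 ->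
  exists w v, degree_lt N v /\ u = cl b * inf w + chern b * v.
Proof.
case=> z zN ->; rewrite pull_class => /coh_class0P[c dc].
pose F := homog z; have dF : hdiff F = 0 by apply: cocycle_hdiff.
have FG : invariant_by xpredT F := inv_homog z.
pose C := hpull char_proj (homog c) - prism char_retract F.
have FC : F = hdiff C.
  rewrite hdiffB hdiff_hpull -homog_diff.
  have := prismP char_retract F; rewrite dF [prism _ 0]raddf0 addr0 => ->.
  rewrite -[diff c]/(cochain_val (coboundary c)) dc hpull_retract (homog_hpull _ char_incl_morph).
  by rewrite subKr.
have CW : invariant_by (fun g => b g == 0) C.
  apply: invB; first by rewrite (homog_hpull _ char_proj_morph); apply/invGW/inv_homog.
  by apply: (inv_prism p_pr mulGC (expG t) (dualM b) (fun=> erefl)); apply: invGW.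
have [w [v [C' [[wG dw rw] [vG dv] C'G E]]]] :=
  split_kernel p_pr mulGC (expG t) (dualM b) bt (fun=> erefl) FG dF CW FC.
pose f k := inhomog w (map (@sgval G char_ker) k).
have fw : homog f = hpull (@sgval G char_ker) w by rewrite -homog_hpull // inhomogK.
have fp : homog (fun x => f (map char_proj x)) = w.
  by rewrite -homog_hpull ?fw -?hpull_retract //; apply: char_proj_morph.
have df : diff f = 0 by apply: hdiff_cocycle; rewrite fw hdiff_hpull dw.
have dv' : diff (inhomog v) = 0 by apply: hdiff_cocycle; rewrite inhomogK.
pose zw : cocycle 'F_p K := Cocycle (cocycle_truncation N.+1 df).
pose zv : cocycle 'F_p G := Cocycle (cocycle_truncation N dv').
exists (coh_class zw), (coh_class zv); split.
  by exists zv => // x Nx; rewrite /= /truncate ltnNge Nx.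
have Ez : (z : seq G -> 'F_p) = cup (char_fun b) (fun x => f (map char_proj x))
    + cup (carry_fun 'F_p b) (inhomog v) + diff (inhomog C').
  apply: homog_inj; rewrite 2!homogD homog_char_cup fp homog_carry //.
  by rewrite homog_diff !inhomogK.
rewrite pull_class chernE // clE.
rewrite -!coh_classM -coh_classD; apply/classP; exists (truncation N.+1 (inhomog C')).
apply: cochain_eq => x; rewrite [LHS]diff_truncate.
rewrite -[RHS]/(z x - (cup (char_fun b) (fun x => truncate N.+1 f (map char_proj x)) x
   + cup (carry_fun 'F_p b) (truncate N (inhomog v)) x)).
rewrite (_ : (fun x => truncate N.+1 f (map char_proj x)) =
             truncate N.+1 (fun x => f (map char_proj x))); last first.
  by apply/funext => y; rewrite /truncate size_map.
rewrite (@cup_truncate _ _ 1) => [|[|? [|? ?]]] //.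
rewrite (@cup_truncate _ _ 2) => [|[|? [|? [|? ?]]]] //.
rewrite addn1 addn2; case: ltnP => [_|/zN->]; last by rewrite addr0 subr0.
by rewrite Ez !funDE addrC addKr.
Qed.

Lemma chern_regular v : chern b * v = 0 -> v = 0.
Proof.
elim/class_ind: v => z; rewrite chernE // -coh_classM => /coh_class0P[c dc].
have cG : invariant_by xpredT (homog c) := inv_homog c.
have zG : invariant_by xpredT (homog z) := inv_homog z.
have oG : invariant_by xpredT (0 : seq G -> 'F_p) by [].
have E : hcup1 (fun x y => b y - b x) 0 + hcup2 (carry3 b) (homog z) = hdiff (homog c).
  rewrite -homog_diff -[diff c]/(cochain_val (coboundary c)) dc -homog_carry //.
  by apply/funext => -[|x [|y v]]; rewrite funDE /= ?mulr0 add0r.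
have [e eG ze] := split_inj2 p_pr mulGC (expG t) (dualM b) bt (fun=> erefl) oG zG cG
  (raddf0 _) (cocycle_hdiff z) E erefl.
apply: (class_diff_eq0 (f := inhomog e)); apply: homog_inj.
by rewrite homog_diff inhomogK.
Qed.

Lemma splitting_inj w v : cl b * inf w + chern b * v = 0 -> w = 0 /\ v = 0.
Proof.
elim/class_ind: w => zw; elim/class_ind: v => zv E0; move: (E0).
rewrite pull_class chernE // clE.
rewrite -!coh_classM -coh_classD => /coh_class0P[c dc].
pose w := homog (fun x => zw (map char_proj x)).
have wE : w = hpull char_proj (homog zw).
  by rewrite homog_hpull //; apply: char_proj_morph.
pose v := homog zv; pose g := homog c.
have E : hcup1 (fun x y => b y - b x) w + hcup2 (carry3 b) v = hdiff g.
  rewrite -homog_diff -[diff c]/(cochain_val (coboundary c)) dc.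
  rewrite -homog_char_cup -homog_carry // -homogD; congr homog.
have wG : invariant_by xpredT w by apply: inv_homog.
have vG : invariant_by xpredT v by apply: inv_homog.
have gG : invariant_by xpredT g by apply: inv_homog.
have dw : hdiff w = 0 by rewrite wE hdiff_hpull cocycle_hdiff.
have dv : hdiff v = 0 by apply: cocycle_hdiff.
have rw : hpull char_retract w = w.
  rewrite hpull_retract wE; apply/funext => x; rewrite /hpull -!map_comp.
  by congr (homog _ _); apply: eq_map => y; rewrite /= char_projK.
have [e [eG re we]] :=
  split_inj1 p_pr mulGC (expG t) (dualM b) bt (fun=> erefl) wG vG gG dw dv rw E.
have zw0 : coh_class zw = 0.
  apply: (class_diff_eq0 (f := fun k => inhomog e (map (@sgval G char_ker) k))).
  apply: homog_inj; rewrite homog_diff -(homog_hpull _ char_incl_morph) inhomogK //.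
  rewrite hdiff_hpull -we wE; apply/funext => x; rewrite /hpull -map_comp.
  by rewrite (eq_map (g := id)) ?map_id // => y; rewrite /= char_projK.
split=> //; apply: chern_regular; move: E0.
by rewrite zw0 pull0 mulr0 add0r.
Qed.
End Splitting.

Section Splittings.
Import GRing.Theory.
Local Open Scope ring_scope.

Definition elemab p (G : finGroupType) :=
  (forall x y : G, x * y = y * x)%g /\ (forall x : G, x ^+ p = 1)%g.

Lemma Fp_mulrnV p (c : 'F_p) : c != 0 -> c *+ (c^-1 : 'F_p) = 1.
Proof. by move=> c0; rewrite -mulr_natr natr_Zp; apply: (@mulfV 'F_p _ c0). Qed.

Section OfChar.
Variables (p : nat) (p_pr : prime p) (G : finGroupType) (b : dual p G).

Record splitting := Splitting {
  spl_group : finGroupType;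
  spl_incl : spl_group -> G;
  spl_proj : G -> spl_group;
  spl_inclM : {morph spl_incl : x y / (x * y)%g};
  spl_projM : {morph spl_proj : x y / (x * y)%g};
  spl_elemab : elemab p spl_group;
  spl_card : #|G| = (p * #|spl_group|)%N;
  spl_res_inf : forall u : cohomology 'F_p spl_group,
    pull spl_inclM (pull spl_projM u) = u;
  spl_res_eq0 : forall N (u : cohomology 'F_p G),
    degree_lt N.+1 u -> pull spl_inclM u = 0 ->
    exists w v, degree_lt N v /\ u = cl b * pull spl_projM w + chern b * v;
  spl_inj : forall w v, cl b * pull spl_projM w + chern b * v = 0 -> w = 0 /\ v = 0;
  spl_dual_res : dual_pull spl_inclM b = 0;
  spl_dual_resK : forall c : dual p spl_group, dual_pull spl_inclM (dual_pull spl_projM c) = c;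
  spl_dual : forall c : dual p G,
    exists k, c = b *+ k + dual_pull spl_projM (dual_pull spl_inclM c);
  spl_Ess : forall u, Ess p G u -> pull spl_inclM u = 0;
  spl_restriction : forall (W : {group G}) (u : cohomology 'F_p G),
    (forall x, x \in W -> b x = 0) -> pull spl_inclM u = 0 -> restriction W u = 0
}.

Lemma splitting_exists : elemab p G -> b != 0 -> inhabited splitting.
Proof.
move=> [mulGC expG] b0.
have [x bx] : exists x, b x != 0.
  apply/existsP; apply: contraR b0; rewrite negb_exists => /forallP b0.
  by apply/eqP/dual_eq => x; rewrite dual0E; apply/eqP; have := b0 x; rewrite negbK.
pose t := (x ^+ ((b x)^-1 : 'F_p)%R)%g.
have bt : b t = 1 by rewrite dualX Fp_mulrnV.
pose projM := char_proj_morph p_pr mulGC expG bt.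
have pE := char_projE bt.
constructor; apply: (@Splitting (subg_of (char_ker b)) (@sgval G (char_ker b))
  (char_proj b t) (@char_incl_morph _ _ b) projM).
- by split=> [k1 k2|k]; apply: val_inj; [exact: mulGC|]; rewrite -[LHS]/(sgval _) morphX ?inE ?expG.
- rewrite -[X in (X * _)%N](card_Fp p_pr) mulnC -card_prod.
  apply: (bij_eq_card (f := fun x => (char_proj b t x, b x))).
  exists (fun kj : subg_of (char_ker b) * 'F_p => sgval kj.1 * t ^+ kj.2)%g => [y|[k j]] /=.
    by rewrite pE /char_retract mulgKV.
  have bkj : b (sgval k * t ^+ j)%g = j.
    by rewrite dualM char_sgval add0r dualX bt natr_Zp.
  rewrite bkj; congr (_, _); apply: val_inj.
  by rewrite -[LHS]/(sgval _) pE /char_retract bkj mulgK.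
- by move=> u; apply: pull_inclK.
- move=> N u /(@degree_ltW _ _ _ N.+2) uN ru.
  have [w [v [vN ->]]] := restriction_eq0 p_pr mulGC expG bt (uN (leqnSn _)) ru.
  by exists w, v.
- by move=> w v; apply: splitting_inj.
- by apply: dual_eq => k; rewrite dual_pullE dual0E char_sgval.
- by move=> c; apply: dual_eq => k; rewrite !dual_pullE char_projK.
- move=> c; exists (c t : nat); apply: dual_eq => y.
  rewrite dualDE dualMnE !dual_pullE pE dualM dualV dualX.
  rewrite -[b y *+ _]mulr_natr -[c t *+ _]mulr_natr !natr_Zp mulrC.
  by rewrite addrC subrK.
- move=> u uE; rewrite -restrictionE; apply: uE.
  rewrite properE finset.subsetT /=; apply/negP => /fintype.subsetP/(_ t).
  by rewrite !inE bt oner_eq0 => /(_ isT).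
- move=> W u bW; rewrite -restrictionE => ru.
  have sgM : {morph @sgval G W : x y / (x * y)%g} by [].
  have cM : {morph (fun w : subg_of W => char_proj b t (sgval w)) : x y / (x * y)%g}.
    by move=> w1 w2; rewrite -projM.
  rewrite (restrictionE sgM) -(pull_comp cM (@char_incl_morph _ _ b) sgM).
    by rewrite -restrictionE ru pull0.
  by move=> w; rewrite /= pE /char_retract bW ?invg1 ?mulg1 //; apply: subgP.
Qed.
End OfChar.

Variables (p : nat) (p_pr : prime p).

Lemma elemabP (G : finGroupType) : elemab p G <-> (p.-abelem [set: G])%g.
Proof.
split=> [[mulGC expG]|/(abelemP p_pr)[/centsP cG expG]].
  apply/(abelemP p_pr); split=> [|x _]; last exact: expG.
  by apply/centsP => x _ y _; apply: mulGC.
by split=> [x y|x]; [apply: cG; rewrite inE | apply: expG; rewrite inE].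
Qed.

Lemma separating_char (G : finGroupType) (W : {group G}) :
  elemab p G -> W \proper [set: G] ->
  exists2 b : dual p G, b != 0 & forall x, x \in W -> b x = 0.
Proof.
move=> /elemabP abG /properP[_ [x _ xW]].
have abQ := quotient_abelem W abG.
have nW y : y \in ('N(W))%g.
  have /centsP cG := abelem_abelian abG; apply/normP.
  apply/setP => z; rewrite mem_conjg; congr (_ \in W).
  by rewrite conjgE invgK mulgA (cG y) ?inE // mulgK.
have xQ : coset W x \in ([set: G] / W)%g by rewrite mem_quotient ?inE.
have x1 : coset W x != 1%g by apply: contraNneq xW => /coset_idr; apply.
have ntQ : ([set: G] / W)%g != 1%g.
  by apply: contraNneq x1 => Q1; move: xQ; rewrite Q1 inE.
pose f := abelem_rV abQ ntQ.
have : f (coset W x) != 0.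
  apply: contraNneq x1 => fx0; apply/eqP.
  apply: (@abelem_rV_inj _ _ _ abQ ntQ _ _ xQ (group1 _)).
  by rewrite [LHS]fx0 abelem_rV_1.
case/rV0Pn=> i fxi.
have bM : additive_char [ffun y => f (coset W y) 0 i].
  apply/additive_charP => y z; rewrite !ffunE /f [coset _ _]morphM ?nW // abelem_rV_M ?mxE //;
    by rewrite mem_quotient ?inE.
exists (Dual bM).
  apply: contraNneq fxi => /(congr1 (fun b : dual p G => b x)).
  by rewrite dual0E /= ffunE => ->.
by move=> y yW; rewrite /= ffunE coset_id // /f abelem_rV_1 mxE.
Qed.

Lemma char_exists (G : finGroupType) :
  elemab p G -> (1 < #|G|)%N -> exists b : dual p G, b != 0.
Proof.
move=> eG G1; have [|b b0 _] := separating_char (W := 1%G) eG; last by exists b.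
rewrite properEcard finset.subsetT cards1 cardsT; exact: G1.
Qed.

Lemma card1_eq1 (G : finGroupType) (x : G) : #|G| = 1%N -> x = 1%g.
Proof.
move=> G1; have /fintype_le1P GE : (#|G| <= 1)%N by rewrite G1.
exact: GE.
Qed.

Lemma char_trivial (G : finGroupType) (b : dual p G) : #|G| = 1%N -> b = 0.
Proof.
by move=> G1; apply: dual_eq => x; rewrite (card1_eq1 x G1) dual1 dual0E.
Qed.

Lemma cohomology_trivial (G : finGroupType) (u : cohomology 'F_p G) :
  #|G| = 1%N -> exists k, u = 1 *+ k.
Proof.
move=> G1; have {}G1 (x : G) := card1_eq1 x G1.
elim/class_ind: u => z; exists (z [::] : nat).
apply/eqP; rewrite -subr_eq0; apply/eqP.
rewrite -[1]/(coh_class 1) -raddfMn -raddfB /=.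
set z1 := z - 1 *+ _.
pose k (v : seq G) := homog z1 (1%g :: v).
have kG : invariant_by xpredT (k : seq G -> 'F_p).
  split=> [|g _].
    rewrite -[LHS]/(z [::] - (1 *+ (z [::] : nat) : cocycle 'F_p G) [::]).
    have -> (m : nat) : (1 *+ m : cocycle 'F_p G) [::] = m%:R.
      by elim: m => // m IHm; rewrite !mulrS -IHm.
    by rewrite natr_Zp subrr.
  apply/funext => v; rewrite /shift /hpull; congr (k _).
  by rewrite (eq_map (g := id)) ?map_id // => x; rewrite [RHS]G1 [LHS]G1.
apply: (class_diff_eq0 (f := inhomog k)); apply: homog_inj.
rewrite homog_diff inhomogK //; apply/funext => v; apply/eqP; rewrite -subr_eq0; apply/eqP.
exact: (congr1 (@^~ (1%g :: v)) (cocycle_hdiff z1)).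
Qed.
End Splittings.

Arguments spl_inclM {p G b} s.
Arguments spl_projM {p G b} s.
Arguments spl_elemab {p G b} s.
Arguments spl_card {p G b} s.
Arguments spl_res_inf {p G b} s.
Arguments spl_res_eq0 {p G b} s.
Arguments spl_inj {p G b} s.
Arguments spl_dual_res {p G b} s.
Arguments spl_dual_resK {p G b} s.
Arguments spl_dual {p G b} s.
Arguments spl_Ess {p G b} s.
Arguments spl_restriction {p G b} s.

Section LowDegreeCommutation.
Import GRing.Theory.
Local Open Scope ring_scope.
Variables (p : nat) (p_pr : prime p) (G : finGroupType).
Hypothesis mulGC : forall x y : G, (x * y = y * x)%g.
Implicit Types b c : dual p G.

Lemma diff_homogeneous (R : comNzRingType) m (f : seq G -> R) v :
  (forall w, size w != m -> f w = 0) -> size v != m.+1 -> diff f v = 0.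
Proof.
move=> fm vm; have [/size0nil->//|v_gt0] := posnP (size v).
rewrite diffE // big1 // => i _; have le_i : (i <= size v)%N := ltn_ord i.
by rewrite fm ?mulr0 // (size_face le_i) -eqSS prednK.
Qed.

Lemma diff3 (R : comNzRingType) (f : seq G -> R) x y z :
  diff f [:: x; y; z] =
    f [:: y; z] - f [:: (x * y)%g; z] + f [:: x; (y * z)%g] - f [:: x; y].
Proof.
rewrite /diff !big_ord_recl big_ord0 mul1r addr0 expr1 mulN1r.
rewrite -signr_odd mul1r -signr_odd expr1 mulN1r.
by rewrite !addrA.
Qed.

Lemma cup_size m k (R : comNzRingType) (f g : seq G -> R) v :
  (forall w, size w != m -> f w = 0) -> (forall w, size w != k -> g w = 0) ->
  size v != (m + k)%N -> cup f g v = 0.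
Proof.
move=> fm gk vmk; rewrite (cup_homogeneous _ _ fm); case: leqP => // le_mv.
by rewrite gk ?mulr0 // size_drop -(eqn_add2l m) subnKC.
Qed.

Lemma cl_anticomm b c : cl b * cl c = - (cl c * cl b).
Proof.
apply/eqP; rewrite -addr_eq0; apply/eqP.
rewrite !clE -!coh_classM -coh_classD.
pose f (v : seq G) := if v is [:: x] then - (b x * c x) else 0.
apply: (class_diff_eq0 (f := f)); apply/funext => v.
have f1 w : size w != 1%N -> f w = 0 by case: w => [|? []].
have c1 (d : dual p G) w : size w != 1%N -> char_fun d w = 0 by case: w => [|? []].
rewrite -[LHS]/(cup (char_fun b) (char_fun c) v + cup (char_fun c) (char_fun b) v).
have [v2|v2] := eqVneq (size v) 2; last first.
  by rewrite (diff_homogeneous f1) // !(cup_size (c1 _) (c1 _)) // addr0.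
case: v v2 => [|x [|y []]] // _; rewrite diff2 !(cup_homogeneous _ _ (c1 _)) /=.
by rewrite !dualM; ring.
Qed.

Lemma chern_comm_cl b c : chern b * cl c = cl c * chern b.
Proof.
apply/eqP; rewrite -subr_eq0; apply/eqP; rewrite chernE // clE -!coh_classM -raddfB /=.
pose f (v : seq G) : 'F_p := if v is [:: x; y] then carry_fun _ b v * c (x * y)%g else 0.
apply: (class_diff_eq0 (f := f)); apply/funext => v.
have f2 w : size w != 2%N -> f w = 0 by case: w => [|? [|? []]].
have c1 w : size w != 1%N -> char_fun c w = 0 by case: w => [|? []].
have x2 w : size w != 2%N -> carry_fun 'F_p b w = 0 by case: w => [|? [|? []]].
rewrite -[LHS]/(cup (carry_fun _ b) (char_fun c) v - cup (char_fun c) (carry_fun _ b) v).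
have [v3|v3] := eqVneq (size v) 3; last first.
  by rewrite (diff_homogeneous f2) // (cup_size x2 c1) // (cup_size c1 x2) // subr0.
case: v v3 => [|x [|y [|z []]]] // _.
rewrite diff3 (cup_homogeneous _ _ c1) (cup_homogeneous _ _ x2) /=.
have := congr1 (fun e : cochain 'F_p G => e [:: x; y; z])
  (coboundary_cocycle (carry_cocycle p_pr mulGC b)).
rewrite -[LHS]/(diff (carry_fun _ b) [:: x; y; z]) -[RHS]/0 diff3 /= => /eqP.
rewrite subr_eq add0r => /eqP E.
rewrite !dualM -E; ring.
Qed.

End LowDegreeCommutation.

Section Characteristic.
Import GRing.Theory.
Local Open Scope ring_scope.
Variables (p : nat) (p_pr : prime p) (G : finGroupType).
Hypothesis mulGC : forall x y : G, (x * y = y * x)%g.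
Implicit Types b c : dual p G.

Lemma chern_comm b c : chern b * chern c = chern c * chern b.
Proof.
have := congr1 (@bockstein p G) (chern_comm_cl p_pr mulGC c b).
rewrite (bockstein_chern_mul p_pr mulGC c (cl b)) (bockstein_cl_mul p_pr b (chern c)).
by rewrite bockstein_cl (bockstein_chern p_pr c) mulr0 subr0 => ->.
Qed.

Lemma cohomology_mulrn (u : cohomology 'F_p G) : u *+ p = 0.
Proof.
elim/class_ind: u => z; rewrite -raddfMn (_ : z *+ p = 0) ?raddf0 //.
apply/val_inj/cochain_eq => w.
have -> k : cocycle_val (z *+ k) w = z w *+ k by elim: k => // k IHk; rewrite !mulrS -IHk.
by rewrite mulrn_pchar // pchar_Fp.
Qed.

Lemma cl_sqr b : odd p -> cl b * cl b = 0.
Proof.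
move=> p_odd; have uu : cl b * cl b + cl b * cl b = 0 by rewrite {1}cl_anticomm addNr.
move: (cl b * cl b) uu => u uu.
have : u *+ (odd p + p./2.*2) = u.
  by rewrite p_odd -mul2n mulrS mulrnA mulr2n uu mul0rn addr0.
by rewrite odd_double_half cohomology_mulrn.
Qed.

Lemma cl0 : cl (0 : dual p G) = 0. Proof. by rewrite -(subrr 0) clB subrr. Qed.
Lemma clN b : cl (- b) = - cl b. Proof. by rewrite -sub0r clB cl0 sub0r. Qed.
Lemma clD b c : cl (b + c) = cl b + cl c.
Proof. by rewrite -{1}[c]opprK clB clN opprK. Qed.
Lemma clMn b k : cl (b *+ k) = cl b *+ k.
Proof. by elim: k => [|k IHk]; rewrite ?cl0 // !mulrS clD IHk. Qed.

Lemma chern0 : chern (0 : dual p G) = 0.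
Proof. by rewrite -(subrr 0) chernB // subrr. Qed.
Lemma chernD b c : chern (b + c) = chern b + chern c.
Proof. by rewrite -{1}[c]opprK chernB // -sub0r chernB // chern0 sub0r opprK. Qed.
Lemma chernMn b k : chern (b *+ k) = chern b *+ k.
Proof. by elim: k => [|k IHk]; rewrite ?chern0 // !mulrS chernD IHk. Qed.
End Characteristic.

Section RingLemmas.
Import GRing.Theory.
Local Open Scope ring_scope.
Variable A : pzRingType.

Lemma comm_mul3 (x a u : A) : x * a = a * x -> x * u = u * x -> x * (a * u) = a * u * x.
Proof. by move=> xa xu; rewrite mulrA xa -mulrA xu mulrA. Qed.

Lemma mul_decomp (x X a r w v c z : A) k :
  c = x *+ k + X -> X * a = a * X -> c * x = x * c -> c * (r + a * w + x * v) = x * z ->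
  X * r + a * (X * w) + x * (c * v + (r + a * w) *+ k - z) = 0.
Proof.
move=> cE Xa cx E.
have -> : X * r + a * (X * w) = X * (r + a * w) by rewrite mulrDr [in RHS]mulrA Xa -mulrA.
have ct : c * (r + a * w) = x * (r + a * w) *+ k + X * (r + a * w).
  by rewrite cE mulrDl mulrnAl.
rewrite mulrBr -E (mulrDr c) ct [c * (x * v)]mulrA cx -mulrA (mulrDr x (c * v)) mulrnAr.
by rewrite [X in _ - X]addrC [X in _ - X]addrA opprD [X in _ + X]addrA subrr add0r subrr.
Qed.

End RingLemmas.

Section CohomologyElemab.
Import GRing.Theory.
Local Open Scope ring_scope.
Variables (p : nat) (p_pr : prime p).

Lemma generated_ind n (G : finGroupType) (P : cohomology 'F_p G -> Prop) :
    elemab p G -> #|G| = (p ^ n)%N ->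
    P 0 -> P 1 -> (forall u v, P u -> P v -> P (u + v)) ->
    (forall b u, P u -> P (cl b * u)) -> (forall b u, P u -> P (chern b * u)) ->
  forall u, P u.
Proof.
elim: n G P => [|n IHn] G P eG cG P0 P1 PD Pcl Pch u.
  have [k ->] := cohomology_trivial u cG.
  by elim: k => [|k IHk]; rewrite ?mulr0n // mulrS; apply: PD.
have [|b b0] := char_exists p_pr eG.
  by rewrite cG -(exp1n n.+1) ltn_exp2r // prime_gt1.
have [S] := splitting_exists p_pr eG b0.
have cS : #|spl_group S| = (p ^ n)%N.
  by apply/eqP; rewrite -(eqn_pmul2l (prime_gt0 p_pr)) -spl_card cG expnS.
have Pinf r : P (pull (spl_projM S) r).
  apply: (IHn _ (fun r => P (pull (spl_projM S) r)) (spl_elemab S) cS).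
  - by rewrite pull0.
  - by rewrite pull1.
  - by move=> u1 u2 Pu1 Pu2; rewrite pullD; apply: PD.
  - by move=> c u1 Pu1; rewrite pullM pull_cl; apply: Pcl.
  - by move=> c u1 Pu1; rewrite pullM pull_chern //; apply: Pch.
have [N uN] := degree_ltP u.
elim: N u uN => [|N IHN] u uN; first by rewrite (degree_lt0 uN).
rewrite -(subrK (pull (spl_projM S) (pull (spl_inclM S) u)) u); apply: (PD) => //.
have [||w [v [vN ->]]] := spl_res_eq0 S N (u - pull (spl_projM S) (pull (spl_inclM S) u)).
- by apply: degree_ltB => //; do 2!apply: degree_pull.
- by rewrite pullB spl_res_inf subrr.
- by apply: PD; [apply: Pcl | apply/Pch/IHN].
Qed.

Lemma splitting_decomp (G : finGroupType) (b : dual p G) (S : splitting b) N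
    (u : cohomology 'F_p G) : degree_lt N.+1 u ->
  exists r w v, degree_lt N v /\
    u = pull (spl_projM S) r + cl b * pull (spl_projM S) w + chern b * v.
Proof.
move=> uN; pose r := pull (spl_inclM S) u.
have [||w [v [vN E]]] := spl_res_eq0 S N (u - pull (spl_projM S) r).
- by apply: degree_ltB => //; do 2!apply: degree_pull.
- by rewrite pullB spl_res_inf subrr.
by exists r, w, v; split=> //; rewrite -addrA -E addrC subrK.
Qed.

Section OneGroup.
Variables (n : nat) (G : finGroupType).
Hypotheses (eG : elemab p G) (cG : #|G| = (p ^ n)%N).
Implicit Types b c : dual p G.

Lemma chern_central b u : chern b * u = u * chern b.
Proof.
move: u; apply: (generated_ind eG cG) => [||u v IHu IHv|c u IHu|c u IHu].
- by rewrite mulr0 mul0r.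
- by rewrite mulr1 mul1r.
- by rewrite mulrDr mulrDl IHu IHv.
- exact: comm_mul3 (chern_comm_cl p_pr eG.1 b c) IHu.
- exact: comm_mul3 (chern_comm p_pr eG.1 b c) IHu.
Qed.

Lemma chern_nonzero_regular b u : b != 0 -> chern b * u = 0 -> u = 0.
Proof.
move=> b0 bu; have [S] := splitting_exists p_pr eG b0.
by have [] := spl_inj S 0 u; rewrite ?pull0 ?mulr0 ?add0r.
Qed.

Lemma spl_regular b (S : splitting b) (r w : cohomology 'F_p (spl_group S)) v :
  pull (spl_projM S) r + cl b * pull (spl_projM S) w + chern b * v = 0 ->
  [/\ r = 0, w = 0 & v = 0].
Proof.
move=> E; have r0 : r = 0.
  have := congr1 (pull (spl_inclM S)) E.
  rewrite !pullD !pullM pull_cl pull_chern // spl_dual_res !spl_res_inf.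
  by rewrite cl0 chern0 // !mul0r !addr0 pull0.
by move: E; rewrite r0 pull0 add0r => /(spl_inj S)[-> ->].
Qed.

Lemma chern_coprime b c y z : b != 0 -> (forall k, c != b *+ k) ->
  chern c * y = chern b * z -> exists y', y = chern b * y'.
Proof.
move=> b0 cb E; have [S] := splitting_exists p_pr eG b0.
have [N yN] := degree_ltP y.
have [r [w [v [_ Ey]]]] := splitting_decomp S (degree_ltW (leqnSn N) yN).
have [k Ec] := spl_dual S c; set d := dual_pull _ c in Ec.
have d0 : d != 0.
  apply: contraNneq (cb k) => d0; rewrite {1}Ec d0; apply/eqP/dual_eq => x.
  by rewrite dualDE [X in _ + X]dual_pullE dual0E addr0.
have Ech : chern c = chern b *+ k + pull (spl_projM S) (chern d).
  by rewrite {1}Ec chernD // chernMn // pull_chern.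
have regd x : chern d * x = 0 -> x = 0.
  move=> dx; have [T] := splitting_exists p_pr (spl_elemab S) d0.
  by have [] := spl_inj T 0 x; rewrite ?pull0 ?mulr0 ?add0r.
have [/regd r0 /regd w0 _] : [/\ chern d * r = 0, chern d * w = 0 &
    chern c * v + (pull (spl_projM S) r + cl b * pull (spl_projM S) w) *+ k - z = 0].
  apply: spl_regular; rewrite !pullM.
  apply: (mul_decomp Ech _ (chern_comm p_pr eG.1 c b)); last by rewrite -Ey.
  by rewrite (pull_chern p_pr); apply: (chern_comm_cl p_pr eG.1).
by exists v; rewrite Ey r0 w0 !pull0 mulr0 !add0r.
Qed.

End OneGroup.

Hypothesis p_odd : odd p.

Definition prod_cl (G : finGroupType) (s : seq (dual p G)) : cohomology 'F_p G :=
  \prod_(b <- s) cl b.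

Lemma prod_cl_cons G (b : dual p G) s : prod_cl (b :: s) = cl b * prod_cl s.
Proof. by rewrite /prod_cl big_cons. Qed.

Lemma pull_prod_cl (K G : finGroupType) (phi : K -> G)
    (phiM : {morph phi : x y / (x * y)%g}) (s : seq (dual p G)) :
  pull phiM (prod_cl s) = prod_cl (map (dual_pull phiM) s).
Proof.
elim: s => [|b s IHs]; first by rewrite /prod_cl !big_nil pull1.
by rewrite /= !prod_cl_cons pullM pull_cl IHs.
Qed.

Lemma cl_prod_cl_res (G : finGroupType) (b : dual p G) (S : splitting b) s :
  elemab p G ->
  cl b * prod_cl s =
    cl b * pull (spl_projM S) (prod_cl (map (dual_pull (spl_inclM S)) s)).
Proof.
move=> [mulGC _]; elim: s => [|c s IHs]; first by rewrite /prod_cl !big_nil pull1.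
rewrite /= !prod_cl_cons pullM pull_cl.
have -> : cl b * (cl c * prod_cl s) =
    cl b * (cl (dual_pull (spl_projM S) (dual_pull (spl_inclM S) c)) * prod_cl s).
  have [k {1}->] := spl_dual S c.
  by rewrite clD clMn !mulrA mulrDr mulrnAr cl_sqr // mul0rn add0r.
by rewrite !mulrA cl_anticomm // !mulNr -!mulrA IHs.
Qed.

Lemma prod_cl_eq0 n (G : finGroupType) (s : seq (dual p G)) :
  elemab p G -> #|G| = (p ^ n)%N -> (n < size s)%N -> prod_cl s = 0.
Proof.
elim: n G s => [|n IHn] G [|b s] // eG cG; rewrite prod_cl_cons.
  by rewrite (char_trivial b cG) cl0 mul0r.
have [->|b0] := eqVneq b 0; first by rewrite cl0 mul0r.
have [S] := splitting_exists p_pr eG b0 => ltns.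
rewrite (cl_prod_cl_res S) // IHn ?pull0 ?mulr0 ?size_map //; first exact: spl_elemab.
by apply/eqP; rewrite -(eqn_pmul2l (prime_gt0 p_pr)) -spl_card cG expnS.
Qed.

Lemma annihilator_of_degree1 n (G : finGroupType) :
  elemab p G -> #|G| = (p ^ n)%N ->
  exists2 s : seq (dual p G), size s = n & forall u,
    (forall b, cl b * u = 0) -> exists h, u = prod_cl s * h.
Proof.
elim: n G => [|n IHn] G eG cG.
  by exists [::] => // u _; exists u; rewrite /prod_cl big_nil mul1r.
have [|b b0] := char_exists p_pr eG.
  by rewrite cG -(exp1n n.+1) ltn_exp2r // prime_gt1.
have [S] := splitting_exists p_pr eG b0.
have cS : #|spl_group S| = (p ^ n)%N.
  by apply/eqP; rewrite -(eqn_pmul2l (prime_gt0 p_pr)) -spl_card cG expnS.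
have [s sz_s IHs] := IHn _ (spl_elemab S) cS.
exists (b :: map (dual_pull (spl_projM S)) s); first by rewrite /= size_map sz_s.
move=> u; have [N uN] := degree_ltP u.
elim: N u uN => [|N IHN] u uN u0.
  by exists 0; rewrite (degree_lt0 uN) mulr0.
have [r [w [v [vN Eu]]]] := splitting_decomp S uN.
have mulGC := eG.1.
have bb := cl_sqr p_pr b p_odd.
have [r0 bv0] : r = 0 /\ cl b * v = 0.
  have := u0 b; rewrite Eu !mulrDr [cl b * (cl b * _)]mulrA bb mul0r addr0.
  rewrite [cl b * (chern b * v)]mulrA -chern_comm_cl // -mulrA.
  by move/(spl_inj S).
have wv0 c : cl c * w = 0 /\ cl (dual_pull (spl_projM S) c) * v = 0.
  have := u0 (dual_pull (spl_projM S) c); rewrite Eu r0 pull0 add0r.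
  set c' := dual_pull _ c.
  have -> : cl c' * (cl b * pull (spl_projM S) w + chern b * v)
      = cl b * pull (spl_projM S) (- (cl c * w)) + chern b * (cl c' * v).
    rewrite mulrDr pullN pullM pull_cl -/c' !mulrA cl_anticomm -chern_comm_cl //.
    by rewrite mulNr mulrN mulrA.
  by move=> /(spl_inj S)[/eqP]; rewrite oppr_eq0 => /eqP.
have [h Ew] : exists h, w = prod_cl s * h by apply: IHs => c; have [] := wv0 c.
have [h' Ev] : exists h, v = prod_cl (b :: map (dual_pull (spl_projM S)) s) * h.
  apply: IHN => // c; have [k ->] := spl_dual S c.
  by rewrite clD clMn mulrDl mulrnAl bv0 mul0rn add0r (wv0 _).2.
exists (pull (spl_projM S) h + chern b * h').
rewrite Eu r0 pull0 add0r Ew Ev pullM pull_prod_cl mulrDr !mulrA.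
by rewrite -prod_cl_cons (chern_central eG cG).
Qed.

End CohomologyElemab.

Section EssentialClasses.
Import GRing.Theory.
Local Open Scope ring_scope.
Variables (p : nat) (p_pr : prime p) (G : finGroupType).
Hypothesis eG : elemab p G.
Implicit Types (b : dual p G) (u v w : cohomology 'F_p G).

Lemma EssP u : Ess p G u <->
  forall b, b != 0 -> exists w v, u = cl b * w + chern b * v.
Proof.
split=> [uE b b0|uE W ltWG].
  have [S] := splitting_exists p_pr eG b0; have [N uN] := degree_ltP u.
  have [w [v [_ ->]]] := spl_res_eq0 S N u (degree_ltW (leqnSn N) uN) (spl_Ess S u uE).
  by exists (pull (spl_projM S) w), v.
have [b b0 bW] := separating_char p_pr eG ltWG.
have [S] := splitting_exists p_pr eG b0; apply: (spl_restriction S W) => //.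
have [w [v ->]] := uE b b0; rewrite pullD !pullM pull_cl pull_chern // spl_dual_res.
by rewrite cl0 chern0 // !mul0r addr0.
Qed.

Lemma Ess_two_sided_ideal : two_sided_ideal (Ess p G).
Proof.
have incl_morph (W : {group G}) : {morph @sgval G W : x y / (x * y)%g} by [].
split=> [W _|u v uE vE W ltW|u v vE W ltW|u v uE W ltW];
  rewrite (restrictionE (@incl_morph W)).
- exact: pull0.
- by rewrite pullD -!restrictionE uE ?vE ?addr0.
- by rewrite pullM -[X in _ * X]restrictionE vE ?mulr0.
- by rewrite pullM -[X in X * _]restrictionE uE ?mul0r.
Qed.

Lemma Ess_bockstein u : Ess p G u -> Ess p G (bockstein u).
Proof.
move=> /EssP uE; apply/EssP => b b0; have [w [v ->]] := uE b b0.
exists (- bockstein w), (w + bockstein v).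
rewrite bocksteinD // bockstein_cl_mul //
  bockstein_chern_mul //; last exact: eG.1.
by rewrite mulrN mulrDr addrCA addrA.
Qed.
End EssentialClasses.

Section ReducedPowers.
Import GRing.Theory.
Local Open Scope ring_scope.
Variables (p : nat) (p_pr : prime p) (G : finGroupType).
Variable P : nat -> cohomology 'F_p G -> cohomology 'F_p G.
Hypothesis P_powers : reduced_powers P.
Implicit Types (b : dual p G) (u v w : cohomology 'F_p G).

Lemma power0 m : P m 0 = 0.
Proof. by apply: (@addrI _ (P m 0)); rewrite -(reduced_powerD P_powers) !addr0. Qed.

Lemma powerN m u : P m (- u) = - P m u.
Proof. by apply/eqP; rewrite -addr_eq0 -(reduced_powerD P_powers) addNr power0. Qed.

Lemma powerB m u v : P m (u - v) = P m u - P m v.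
Proof. by rewrite (reduced_powerD P_powers) powerN. Qed.

Lemma power_cl m b u : P m (cl b * u) = cl b * P m u.
Proof.
rewrite (reduced_power_cartan P_powers) big_ord_recl (reduced_power0 P_powers) subn0.
rewrite big1 ?addr0 // => i _.
by rewrite (reduced_power_deg1 P_powers) ?mul0r //; apply: degree1_of_cl.
Qed.

(* [P (m - j)], read as [0] when [m < j].                                     *)
Definition power_sub m j u := if (j <= m)%N then P (m - j) u else 0.

Lemma power_sub0 m u : power_sub m 0 u = P m u.
Proof. by rewrite /power_sub subn0. Qed.

Lemma power_sub_chern m j b u :
  power_sub m j (chern b * u) =
    chern b * power_sub m j u + chern b ^+ p * power_sub m j.+1 u.
Proof.
rewrite /power_sub; case: (leqP j m) => [le_jm|lt_mj]; last first.
  by rewrite ltnNge (ltnW lt_mj) !mulr0 addr0.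
rewrite (reduced_power_cartan P_powers) big_ord_recl (reduced_power0 P_powers) subn0.
congr (_ + _); have [lt_jm|le_mj] := ltnP j m; last first.
  have -> : (m - j = 0)%N by apply/eqP; rewrite subn_eq0.
  by rewrite big_ord0 mulr0.
rewrite -[(m - j)%N in LHS]prednK ?subn_gt0 // big_ord_recl.
rewrite -[X in P _ X * _]bockstein_cl (reduced_power1_bockstein P_powers) ?big1 ?addr0; last first.
- exact: degree1_of_cl.
- move=> i _; rewrite -bockstein_cl (reduced_power_bockstein P_powers) ?mul0r //.
  exact: degree1_of_cl.
by rewrite bockstein_cl lift0 subn1 subnS.
Qed.

Lemma power_chernX m i k b u :
  power_sub m i (chern b ^+ k * u) =
  \sum_(j < k.+1) (chern b ^+ (k - j + p * j) * power_sub m (i + j) u) *+ 'C(k, j).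
Proof.
elim: k i u => [|k IHk] i u.
  by rewrite big_ord1 muln0 !addn0 !expr0 !mul1r mulr1n.
pose f j := chern b ^+ (k.+1 - j + p * j) * power_sub m (i + j) u.
rewrite exprSr -mulrA IHk.
transitivity (\sum_(j < k.+1) f j *+ 'C(k, j) + \sum_(j < k.+1) f j.+1 *+ 'C(k, j)).
  rewrite -big_split; apply: eq_bigr => j _; rewrite /= -mulrnDl; congr (_ *+ _).
  have le_jk : (j <= k)%N := ltn_ord j.
  rewrite power_sub_chern mulrDr !mulrA -exprSr -exprD /f; congr (_ ^+ _ * _ + _ ^+ _ * _).
  - by rewrite subSn.
  - by rewrite subSS mulnS [(p + _)%N]addnC addnA.
  - by rewrite addnS.
rewrite [RHS]big_ord_recl [in RHS](eq_bigr (fun j : 'I_k.+1 =>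
   f j.+1 *+ 'C(k, j.+1) + f j.+1 *+ 'C(k, j))); last first.
  by move=> j _; rewrite -mulrnDr -binS.
rewrite big_split addrA; congr (_ + _).
transitivity (\sum_(j < k.+2) f j *+ 'C(k, j)).
  by rewrite [RHS]big_ord_recr /= bin_small // mulr0n addr0.
by rewrite big_ord_recl !bin0.
Qed.

Lemma bin_pexp k j : (0 < j < p ^ k)%N -> (p %| 'C(p ^ k, j))%N.
Proof.
case: j => // j /andP[_ ltj]; apply: contraLR (ltj) => pC; rewrite -leqNgt.
apply: dvdn_leq => //; have co : coprime (p ^ k) 'C(p ^ k, j.+1).
  by rewrite coprimeXl // prime_coprime.
rewrite -(Gauss_dvdl _ co) -mul_bin_diag dvdn_mulr //.
Qed.

Lemma power_chern_pexp m k b u :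
  P m (chern b ^+ (p ^ k) * u) =
    chern b ^+ (p ^ k) * P m u + chern b ^+ (p ^ k.+1) * power_sub m (p ^ k) u.
Proof.
rewrite -[LHS]power_sub0 power_chernX.
have pk0 : (0 < p ^ k)%N by rewrite expn_gt0 prime_gt0.
rewrite (bigD1 ord0) //= (bigD1 ord_max) /=; last by rewrite -(inj_eq val_inj) /= -lt0n.
rewrite big1 => [|j /andP[j0 jq]]; last first.
  have /dvdnP[d ->] : (p %| 'C(p ^ k, j))%N.
    apply: bin_pexp; rewrite lt0n j0 /= ltn_neqAle -ltnS ltn_ord andbT.
    by move: jq; rewrite -(inj_eq val_inj).
  by rewrite mulrnA cohomology_mulrn.
by rewrite bin0 binn !mulr1n subn0 subnn muln0 addn0 !add0n addr0 -expnS power_sub0.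
Qed.

End ReducedPowers.

Section MilnorOperations.
Import GRing.Theory.
Local Open Scope ring_scope.
Variables (p : nat) (p_pr : prime p) (n : nat) (G : finGroupType).
Hypotheses (eG : elemab p G) (cG : #|G| = (p ^ n)%N).
Variable P : nat -> cohomology 'F_p G -> cohomology 'F_p G.
Hypothesis P_powers : reduced_powers P.
Implicit Types (b : dual p G) (u v w : cohomology 'F_p G).

Lemma power_chern m b u : P m (chern b * u) = chern b * P m u + chern b ^+ p * power_sub P m 1 u.
Proof. by rewrite -!(power_sub0 P m) (power_sub_chern P_powers). Qed.

Lemma power1 m : (0 < m)%N -> P m 1 = 0.
Proof.
elim/ltn_ind: m => -[//|m] IHm _.
have := reduced_power_cartan P_powers m.+1 1 1.
rewrite mulr1 big_ord_recl big_ord_recr (reduced_power0 P_powers) /= mul1r subn0.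
rewrite big1 ?add0r => [|i _]; last first.
  by rewrite IHm ?mul0r // /bump leq0n add1n // ltnS.
rewrite /bump leq0n add1n subnn (reduced_power0 P_powers) mulr1 => /eqP.
by rewrite -subr_eq subrr => /eqP <-.
Qed.

Lemma Ess_power m u : Ess p G u -> Ess p G (P m u).
Proof.
move=> /(EssP p_pr eG) uE; apply/(EssP p_pr eG) => b b0; have [w [v ->]] := uE b b0.
exists (P m w), (P m v + chern b ^+ p.-1 * power_sub P m 1 v).
rewrite (reduced_powerD P_powers) (power_cl P_powers) power_chern.
by rewrite mulrDr [chern b * (chern b ^+ _ * _)]mulrA -exprS prednK ?prime_gt0.
Qed.

Fixpoint milnor i u :=
  if i is j.+1 then P (p ^ j) (milnor j u) - milnor j (P (p ^ j) u) else bockstein u.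

Lemma bockstein1 : bockstein (1 : cohomology 'F_p G) = 0.
Proof.
have h0 : homogeneous 0 (1 : cocycle 'F_p G) by case.
have := bocksteinM p_pr 1 h0; rewrite expr0 !mul1r mulr1 => /eqP.
by rewrite -subr_eq subrr => /eqP <-.
Qed.

Record antiderivation i (Q : cohomology 'F_p G -> cohomology 'F_p G) : Prop := {
  antiderD : forall u v, Q (u + v) = Q u + Q v;
  antider1 : Q 1 = 0;
  antider_cl : forall b u, Q (cl b * u) = chern b ^+ (p ^ i) * u - cl b * Q u;
  antider_chern : forall b u, Q (chern b * u) = chern b * Q u }.

Lemma antider0 i Q : antiderivation i Q -> Q 0 = 0.
Proof. by move=> aQ; apply: (@addrI _ (Q 0)); rewrite -(antiderD aQ) !addr0. Qed.

Lemma antiderN i Q u : antiderivation i Q -> Q (- u) = - Q u.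
Proof. by move=> aQ; apply/eqP; rewrite -addr_eq0 -(antiderD aQ) addNr (antider0 aQ). Qed.

Lemma antiderB i Q u v : antiderivation i Q -> Q (u - v) = Q u - Q v.
Proof. by move=> aQ; rewrite (antiderD aQ) (antiderN _ aQ). Qed.

Let comm_power Q m u := P m (Q u) - Q (P m u).

Lemma comm_power_cl i Q m b u : antiderivation i Q ->
  comm_power Q m (cl b * u) =
    chern b ^+ (p ^ i.+1) * power_sub P m (p ^ i) u - cl b * comm_power Q m u.
Proof.
move=> aQ; rewrite /comm_power (power_cl P_powers) !(antider_cl aQ) (powerB P_powers).
rewrite (power_cl P_powers) (power_chern_pexp p_pr P_powers) mulrBr.
have abel (A : zmodType) (x y z t : A) : x + y - z - (x - t) = y - (z - t).
  by rewrite !opprB [x + y]addrC -!addrA; congr (_ + _); rewrite addrCA [x + _]addrC subrK addrC.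
exact: abel.
Qed.

Lemma comm_power_chern i Q m b u : antiderivation i Q ->
  comm_power Q m (chern b * u) =
    chern b * comm_power Q m u
    + chern b ^+ p * (if m is k.+1 then comm_power Q k u else 0).
Proof.
move=> aQ; rewrite /comm_power (antider_chern aQ) !power_chern (antiderD aQ).
rewrite (antider_chern aQ).
have QX k v : Q (chern b ^+ k * v) = chern b ^+ k * Q v.
  elim: k v => [|k IHk] v; first by rewrite !mul1r.
  by rewrite !exprS -!mulrA (antider_chern aQ) IHk.
rewrite QX.
rewrite opprD addrACA -!mulrBr; congr (_ + _ * _).
by rewrite /power_sub; case: m => [|m]; rewrite ?subn1 //= (antider0 aQ) subrr.
Qed.

Lemma milnorP i : antiderivation i (milnor i).
Proof.
elim: i => [|i aQ].
  split; [exact: bocksteinD | exact: bockstein1 | |].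
    by move=> b u; rewrite expr1 /= (bockstein_cl_mul p_pr).
  by move=> b u; rewrite /= (bockstein_chern_mul p_pr eG.1).
have small m u : (m < p ^ i)%N -> comm_power (milnor i) m u = 0.
  move: u m; apply: (generated_ind p_pr eG cG) => [||u v IHu IHv|b u IHu|b u IHu] m lt_m.
  - by rewrite /comm_power (antider0 aQ) (power0 P_powers) (antider0 aQ) subrr.
  - rewrite /comm_power (antider1 aQ) (power0 P_powers).
    case: m {lt_m} => [|m]; first by rewrite (reduced_power0 P_powers) (antider1 aQ) subrr.
    by rewrite power1 // (antider0 aQ) subrr.
  - rewrite /comm_power (antiderD aQ) !(reduced_powerD P_powers) (antiderD aQ) opprD.
    by rewrite addrACA -!/(comm_power _ _ _) IHu ?IHv ?addr0.
  - rewrite (comm_power_cl _ _ _ aQ) IHu // /power_sub leqNgt lt_m.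
    by rewrite !mulr0 subrr.
  - rewrite (comm_power_chern _ _ _ aQ) IHu // mulr0 add0r.
    by case: m lt_m => [|m] lt_m; rewrite ?IHu ?mulr0 // ltnW.
have pi0 : (0 < p ^ i)%N by rewrite expn_gt0 prime_gt0.
split.
- move=> u v; rewrite /= (antiderD aQ) !(reduced_powerD P_powers) (antiderD aQ) opprD.
  by rewrite addrACA.
- by rewrite /= (antider1 aQ) (power0 P_powers) power1 // (antider0 aQ) subrr.
- move=> b u; rewrite -[LHS]/(comm_power (milnor i) (p ^ i) (cl b * u)).
  rewrite (comm_power_cl _ _ _ aQ) /power_sub leqnn subnn (reduced_power0 P_powers).
  by [].
- move=> b u; rewrite -[LHS]/(comm_power (milnor i) (p ^ i) (chern b * u)).
  rewrite (comm_power_chern _ _ _ aQ); case E: (p ^ i)%N pi0 => [//|k] _.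
  by rewrite (small k) ?E // mulr0 addr0 /comm_power /= E.
Qed.

End MilnorOperations.

Section CharacteristicP.
Import GRing.Theory.
Local Open Scope ring_scope.
Variables (p : nat) (p_pr : prime p) (A : pzRingType).
Hypothesis Ap : forall z : A, z *+ p = 0.
Implicit Types (x y z : A).

Lemma frobenius_comm x y : GRing.comm x y -> (x + y) ^+ p = x ^+ p + y ^+ p.
Proof.
move=> xy; rewrite exprDn_comm // big_ord_recl.
case: p p_pr Ap => [|q] // q_pr Aq; rewrite big_ord_recr /= big1 => [|i _].
  by rewrite bin0 add0r /bump leq0n add1n subnn subn0 binn expr0 mulr1 mul1r.
have /dvdnP[d ->] : (q.+1 %| 'C(q.+1, bump 0 i))%N.
  by apply: prime_dvd_bin => //; rewrite /bump leq0n add1n /= ltnS.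
by rewrite mulrnA Aq.
Qed.

Lemma frobeniusB_comm x y : GRing.comm x y -> (x - y) ^+ p = x ^+ p - y ^+ p.
Proof.
move=> xy; rewrite -[in RHS](subrK y x) (@frobenius_comm (x - y)) ?addrK //.
by apply/commr_sym/commrB => //; apply: commr_sym.
Qed.

Lemma frobeniusXB_comm x y i : GRing.comm x y ->
  (x - y) ^+ (p ^ i) = x ^+ (p ^ i) - y ^+ (p ^ i).
Proof.
move=> xy; elim: i => [|i IHi]; first by rewrite !expr1.
by rewrite expnSr !exprM IHi frobeniusB_comm //; do 2!apply/commrX/commr_sym.
Qed.

Let Fp_p : (Zp_trunc (pdiv p)).+2 = p. Proof. exact: Fp_cast. Qed.

Let mulrn_mod x m : x *+ (m %% p) = x *+ m.
Proof. by rewrite {2}(divn_eq m p) mulrnDr mulrnA Ap add0r. Qed.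

Lemma mulrn_FpD x (a b : 'F_p) : x *+ (a + b)%R = x *+ a + x *+ b.
Proof.
rewrite -mulrnDr -[RHS]mulrn_mod; congr (_ *+ _).
by rewrite -[LHS]/((a + b) %% _)%N [X in (_ %% X)%N]Fp_p.
Qed.

Lemma mulrn_FpM x (a b : 'F_p) : x *+ (a * b)%R = x *+ a *+ b.
Proof.
rewrite -mulrnA -[RHS]mulrn_mod; congr (_ *+ _).
by rewrite -[LHS]/((a * b) %% _)%N [X in (_ %% X)%N]Fp_p.
Qed.

Lemma mulrn_FpB x (a b : 'F_p) : x *+ (a - b)%R = x *+ a - x *+ b.
Proof. by apply/eqP; rewrite eq_sym subr_eq -mulrn_FpD subrK. Qed.

(* The expansion of [\prod_(k <- ks) ('X - k)], homogenized.                   *)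
Lemma prod_homogeneous x y (ks : seq 'F_p) : GRing.comm x y ->
  \prod_(k <- ks) (x - y *+ k) =
  \sum_(i < (size ks).+1) (x ^+ i * y ^+ (size ks - i))
      *+ ((\prod_(k <- ks) ('X - k%:P) : {poly 'F_p})`_i)%R.
Proof.
move=> xy; elim: ks => [|k ks IHks].
  by rewrite !big_nil big_ord1 coef1 /= mul1r mulr1n.
rewrite !big_cons IHks /=; set q := \prod_(k <- ks) _; set m := size ks.
have szq : size q = m.+1 by rewrite size_prod_XsubC.
pose f i (a : 'F_p) := (x ^+ i * y ^+ (m.+1 - i)) *+ a.
transitivity (\sum_(i < m.+2) f i (('X * q)`_i) - \sum_(i < m.+2) f i (k * q`_i)).
  rewrite mulrBl; congr (_ - _).
    rewrite [RHS]big_ord_recl coefXM /= /f mulr0n add0r mulr_sumr; apply: eq_bigr => i _.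
    by rewrite coefXM /= mulrnAr mulrA -exprS.
  rewrite [RHS]big_ord_recr /= [q`_m.+1]nth_default ?szq // mulr0 /f mulr0n addr0.
  rewrite mulr_sumr; apply: eq_bigr => i _; have le_im : (i <= m)%N := ltn_ord i.
  rewrite mulrC mulrn_FpM mulrnAr mulrnAl -!mulrnA mulnC subSn // exprS.
  by rewrite mulrA mulrA (commrX i (commr_sym xy)).
rewrite -sumrB; apply: eq_bigr => i _.
by rewrite /f -mulrn_FpB mulrBl coefB coefCM.
Qed.

Lemma prod_Fp x y : GRing.comm x y ->
  \prod_(k : 'F_p) (x - y *+ k) = x ^+ p - y ^+ p.-1 * x.
Proof.
move=> xy; have := prod_homogeneous (index_enum 'F_p) xy.
have -> : size (index_enum 'F_p) = p by rewrite -[RHS](card_Fp p_pr) cardE enumT.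
rewrite -(finField_genPoly 'F_p) card_Fp // => ->.
have p_gt1 := prime_gt1 p_pr.
have lt1p : (1 < p.+1)%N by rewrite ltnS ltnW.
transitivity (\sum_(i < p.+1) (x ^+ i * y ^+ (p - i) *+ (i == p :> nat)
     - x ^+ i * y ^+ (p - i) *+ (i == 1%N :> nat))).
  apply: eq_bigr => i _; rewrite coefB coefXn coefX mulrn_FpB.
  have E (b : bool) : nat_of_ord (b%:R : 'F_p) = b.
    by rewrite val_Fp_nat // modn_small //; case: b.
  by rewrite !E.
rewrite sumrB (bigD1 ord_max) //= big1 => [|i]; last first.
  by rewrite -(inj_eq val_inj) /= => /negPf->; rewrite mulr0n.
rewrite eqxx subnn mulr1 addr0 (bigD1 (Ordinal lt1p)) //= big1 => [|i]; last first.
  by rewrite -(inj_eq val_inj) /= => /negPf->; rewrite mulr0n.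
by rewrite addr0 expr1 mulr1n subn1 (commrX p.-1 xy).
Qed.
End CharacteristicP.

Section LinearForms.
Import GRing.Theory.
Local Open Scope ring_scope.
Variables (p : nat) (p_pr : prime p).

Section Span.
Variable G : finGroupType.
Implicit Types (b c d : dual p G) (s : seq (dual p G)).

Lemma dual_mulrn b : b *+ p = 0.
Proof. by apply: dual_eq => x; rewrite dualMnE dual0E mulrn_pchar // pchar_Fp. Qed.

Fixpoint in_span s b : Prop :=
  if s is c :: s' then exists k : nat, in_span s' (b - c *+ k) else b = 0.

Fixpoint independent s : Prop :=
  if s is c :: s' then independent s' /\ ~ in_span s' c else True.

Lemma in_span0 s : in_span s 0.
Proof. by elim: s => //= c s IHs; exists 0%N; rewrite subrr. Qed.

Lemma in_spanD s b c : in_span s b -> in_span s c -> in_span s (b + c).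
Proof.
elim: s b c => [|d s IHs] b c /=; first by move=> -> ->; rewrite addr0.
move=> [j bs] [k cs]; exists (j + k)%N.
by rewrite mulrnDr opprD addrACA; apply: IHs.
Qed.

Lemma in_spanMn s b k : in_span s b -> in_span s (b *+ k).
Proof.
move=> bs; elim: k => [|k IHk]; first exact: in_span0.
by rewrite mulrS; apply: in_spanD.
Qed.

Lemma in_spanN s b : in_span s b -> in_span s (- b).
Proof.
move=> bs; have -> : - b = b *+ p.-1; last exact: in_spanMn.
by apply/eqP; rewrite eq_sym -addr_eq0 addrC -mulrS prednK ?prime_gt0 // dual_mulrn.
Qed.

Lemma in_spanB s b c : in_span s b -> in_span s c -> in_span s (b - c).
Proof. by move=> bs cs; apply: in_spanD => //; apply: in_spanN. Qed.

Lemma in_span_Mn_coprime s b m : ~~ (p %| m)%N -> in_span s (b *+ m) -> in_span s b.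
Proof.
move=> pm bs; have m0 : (0 < m)%N by case: m pm {bs}; rewrite ?dvdn0.
case: (egcdnP p m0) => k j kE _.
have := in_spanMn k bs; rewrite -mulrnA mulnC kE.
have /eqP-> : gcdn m p == 1%N by rewrite -/(coprime m p) coprime_sym prime_coprime.
by rewrite addn1 mulrS mulnC mulrnA dual_mulrn mul0rn addr0.
Qed.

Lemma in_span_head c s : in_span (c :: s) c.
Proof. by exists 1%N; rewrite subrr; apply: in_span0. Qed.

Lemma in_span_cons c s b : in_span s b -> in_span (c :: s) b.
Proof. by move=> bs; exists 0%N; rewrite subr0. Qed.

Fixpoint forms b s : seq (dual p G) :=
  if s is c :: s' then
    flatten [seq forms (b - c *+ (k : 'F_p)) s' | k <- index_enum 'F_p]
  else [:: b].

(* If [s] is independent, one representative of each line in its span.        *)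
Fixpoint all_forms s : seq (dual p G) :=
  if s is c :: s' then all_forms s' ++ forms c s' else [::].

Definition nonprop c b := [forall k : 'F_p, b != c *+ k].

Lemma nonpropP c b : nonprop c b -> forall k, b != c *+ k.
Proof.
move=> /forallP cb k; have := cb (k%:R : 'F_p); rewrite val_Fp_nat //.
by rewrite {2}(divn_eq k p) mulrnDr mulnC mulrnA dual_mulrn mul0rn add0r.
Qed.

Lemma forms_span b s d : d \in forms b s -> in_span s (b - d).
Proof.
elim: s b => [|c s IHs] b /=; first by rewrite inE => /eqP->; apply: subrr.
by case/flattenP=> _ /mapP[k _ ->] /IHs; exists k; rewrite addrAC.
Qed.

Lemma forms_not_span b s d : ~ in_span s b -> d \in forms b s -> ~ in_span s d.
Proof. by move=> bs /forms_span bd ds; apply: bs; rewrite -(subrK d b); apply: in_spanD. Qed.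

Lemma all_forms_span s d : d \in all_forms s -> in_span s d.
Proof.
elim: s => //= c s IHs; rewrite mem_cat => /orP[/IHs|/forms_span cd].
  exact: in_span_cons.
have := in_spanB (in_span_head c s) (in_span_cons c cd).
by rewrite opprB addrC subrK.
Qed.

Lemma all_forms_neq0 s d : independent s -> d \in all_forms s -> d != 0.
Proof.
elim: s => //= c s IHs [indep_s cs]; rewrite mem_cat => /orP[/(IHs indep_s)//|].
by move=> /(forms_not_span cs) ds; apply/eqP => d0; apply: ds; rewrite d0; apply: in_span0.
Qed.

Lemma coset_proportional s b d d' k : ~ in_span s b ->
  in_span s (b - d) -> in_span s (b - d') -> d' = d *+ k -> d' = d.
Proof.
move=> bs bd bd' E; pose m := (k + p.-1)%N.
have Mm c : c *+ m = c *+ k - c.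
  apply/eqP; rewrite eq_sym subr_eq -mulrSr /m -addnS prednK ?prime_gt0 //.
  by rewrite mulrnDr dual_mulrn addr0.
have [pm|pm] := boolP (p %| m)%N.
  have := Mm d; have /dvdnP[j ->] := pm; rewrite mulnC mulrnA dual_mulrn mul0rn -E.
  by move/esym/eqP; rewrite subr_eq0 => /eqP.
case: bs; apply: (in_span_Mn_coprime pm).
have := in_spanB (in_spanMn k bd) bd'; rewrite mulrnBl -E opprB addrA subrK.
by rewrite Mm.
Qed.

Lemma forms_pairwise b s : independent s -> ~ in_span s b -> pairwise nonprop (forms b s).
Proof.
elim: s b => [|c s IHs] b //= [indep_s cs] bs.
have bks (k : nat) : ~ in_span s (b - c *+ k) by move=> ?; apply: bs; exists k.
have := index_enum_uniq 'F_p; elim: (index_enum 'F_p) => //= k ks IHks /andP[kks uks].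
rewrite pairwise_cat IHks // IHs //= andbT.
apply/allrelP => d d' dk /flattenP[_ /mapP[k' k'ks ->]] dk'.
apply/forallP => m; apply/eqP => d'E.
have dd : d' = d.
  apply: (coset_proportional (s := c :: s) bs _ _ d'E).
    by exists k; rewrite addrAC; apply: forms_span.
  by exists k'; rewrite addrAC; apply: forms_span.
case/negP: kks; suff -> : k = k' by [].
apply: contra_notP cs => /eqP kk'.
have := in_spanB (forms_span dk') (forms_span dk).
have abel (A : zmodType) (x y z w : A) : x - y - w - (x - z - w) = z - y.
  by rewrite opprB addrA subrK opprB addrC addrA subrK.
rewrite dd abel => kc.
have lt_p (j : 'F_p) : (j < p)%N by rewrite -{2}(Fp_cast p_pr).
have sep (i j : 'F_p) : (i < j)%N -> in_span s (c *+ j - c *+ i) -> in_span s c.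
  move=> lt_ij; rewrite -mulrnBr; last exact: ltnW.
  apply: in_span_Mn_coprime; rewrite gtnNdvd ?subn_gt0 //.
  exact: leq_ltn_trans (leq_subr _ _) (lt_p j).
case: (ltngtP k k') => [lt_kk|lt_kk|/val_inj E]; last by rewrite E eqxx in kk'.
  by apply: sep lt_kk _; rewrite -opprB; apply: in_spanN.
exact: sep lt_kk _.
Qed.

Lemma all_forms_pairwise s : independent s -> pairwise nonprop (all_forms s).
Proof.
elim: s => //= c s IHs [indep_s cs]; rewrite pairwise_cat IHs //= forms_pairwise //.
rewrite andbT; apply/allrelP => d d' ds d'c; apply/forallP => k; apply/eqP => E.
apply: (forms_not_span cs d'c); rewrite E; apply: in_spanMn.
exact: all_forms_span.
Qed.

End Span.

Lemma in_span_pull (K G : finGroupType) (phi : K -> G)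
    (phiM : {morph phi : x y / (x * y)%g}) (s : seq (dual p G)) b :
  in_span s b -> in_span (map (dual_pull phiM) s) (dual_pull phiM b).
Proof.
have pullB c d : dual_pull phiM (c - d) = dual_pull phiM c - dual_pull phiM d.
  by apply: dual_eq => x; rewrite dualBE !dual_pullE dualBE.
have pullMn c k : dual_pull phiM (c *+ k) = dual_pull phiM c *+ k.
  by apply: dual_eq => x; rewrite dualMnE !dual_pullE dualMnE.
elim: s b => [|c s IHs] b /=; first by move=> ->; apply: dual_eq => x; rewrite dual_pullE !dual0E.
by move=> [k bs]; exists k; rewrite -pullMn -pullB; apply: IHs.
Qed.

Lemma basis_exists n (G : finGroupType) : elemab p G -> #|G| = (p ^ n)%N ->
  exists2 s : seq (dual p G), size s = n & independent s.
Proof.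
elim: n G => [|n IHn] G eG cG; first by exists [::].
have [|b b0] := char_exists p_pr eG.
  by rewrite cG -(exp1n n.+1) ltn_exp2r // prime_gt1.
have [S] := splitting_exists p_pr eG b0.
have [|s sz_s indep_s] := IHn _ (spl_elemab S).
  by apply/eqP; rewrite -(eqn_pmul2l (prime_gt0 p_pr)) -spl_card cG expnS.
have resK (s' : seq (dual p (spl_group S))) :
    map (dual_pull (spl_inclM S)) (map (dual_pull (spl_projM S)) s') = s'.
  by rewrite -map_comp (eq_map (g := id)) ?map_id // => c; apply: spl_dual_resK.
exists (b :: map (dual_pull (spl_projM S)) s); first by rewrite /= size_map sz_s.
split.
  elim: s {sz_s} indep_s => //= c s IHs [/IHs ? cs]; split=> // /(in_span_pull (spl_inclM S)).
  by rewrite resK spl_dual_resK.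
have span_inf s' c : in_span (map (dual_pull (spl_projM S)) s') c ->
    exists u, c = dual_pull (spl_projM S) u.
  elim: s' c => [|d s' IHs] c /=.
    by move=> ->; exists 0; apply: dual_eq => x; rewrite dual_pullE !dual0E.
  move=> [k /IHs[u cE]]; exists (u + d *+ k).
  rewrite -[c](subrK (dual_pull (spl_projM S) d *+ k)) cE.
  by apply: dual_eq => x; rewrite dualDE dualMnE !dual_pullE dualDE dualMnE.
move=> /span_inf[u bE]; case/eqP: b0; rewrite bE.
have -> : u = 0 by rewrite -[u](spl_dual_resK S) -bE spl_dual_res.
by apply: dual_eq => x; rewrite dual_pullE !dual0E.
Qed.

End LinearForms.

Section AdditiveForms.
Import GRing.Theory.
Local Open Scope ring_scope.
Variables (p : nat) (p_pr : prime p) (n : nat) (G : finGroupType).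
Hypotheses (eG : elemab p G) (cG : #|G| = (p ^ n)%N).
Variable P : nat -> cohomology 'F_p G -> cohomology 'F_p G.
Hypothesis P_powers : reduced_powers P.
Implicit Types (b c d : dual p G) (s : seq (dual p G)) (u v w z : cohomology 'F_p G).

Definition steenrod_constant z :=
  (forall u, z * u = u * z) /\ (forall i u, milnor P i (z * u) = z * milnor P i u).

Let anti i := milnorP p_pr eG cG P_powers i.

Lemma constant0 : steenrod_constant 0.
Proof. by split=> [u|i u]; rewrite !mul0r ?mulr0 // (antider0 (anti i)). Qed.

Lemma constant1 : steenrod_constant 1.
Proof. by split=> [u|i u]; rewrite !mul1r ?mulr1. Qed.

Lemma constantB z1 z2 :
  steenrod_constant z1 -> steenrod_constant z2 -> steenrod_constant (z1 - z2).
Proof.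
move=> [c1 m1] [c2 m2]; split=> [u|i u]; first by rewrite mulrBl mulrBr c1 c2.
by rewrite !mulrBl (antiderB _ _ (anti i)) m1 m2.
Qed.

Lemma constantM z1 z2 :
  steenrod_constant z1 -> steenrod_constant z2 -> steenrod_constant (z1 * z2).
Proof.
move=> [c1 m1] [c2 m2]; split=> [u|i u]; first by rewrite -mulrA c2 mulrA c1 mulrA.
by rewrite -!mulrA m1 m2.
Qed.

Lemma constantX z k : steenrod_constant z -> steenrod_constant (z ^+ k).
Proof.
move=> cz; elim: k => [|k IHk]; first exact: constant1.
by rewrite exprS; apply: constantM.
Qed.

Lemma constant_chern b : steenrod_constant (chern b).
Proof.
by split=> [u|i u]; [exact: (chern_central p_pr eG cG) | exact: (antider_chern (anti i))].
Qed.

Definition form_prod b s := \prod_(d <- forms b s) chern d.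

Lemma form_prod_cons b c s :
  form_prod b (c :: s) = \prod_(k : 'F_p) form_prod (b - c *+ k) s.
Proof. by rewrite /form_prod /= big_flatten big_map. Qed.

Lemma constant_form_prod b s : steenrod_constant (form_prod b s).
Proof.
rewrite /form_prod; elim: (forms b s) => [|d ds IHd].
  by rewrite big_nil; apply: constant1.
by rewrite big_cons; apply: constantM => //; apply: constant_chern.
Qed.

Let Hp (z : cohomology 'F_p G) : z *+ p = 0. Proof. exact: cohomology_mulrn. Qed.

(* The product of all [X - chern c], for [c] in the span of [s], is an additive
   polynomial in [X]; [form_prod b s] is its value at [chern b].               *)
Lemma form_prodE s : exists (N : nat) (a : nat -> cohomology 'F_p G),
  (forall i, steenrod_constant (a i)) /\
  forall b, form_prod b s = \sum_(i < N) a i * chern b ^+ (p ^ i).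
Proof.
elim: s => [|c s [N [a [aC aE]]]].
  exists 1%N, (fun=> 1); split=> [_|b]; first exact: constant1.
  by rewrite /form_prod big_seq1 big_ord1 mul1r expr1.
pose y := form_prod c s.
have comm b d : GRing.comm (form_prod b s) (form_prod d s).
  exact: (constant_form_prod b s).1.
have EB b k : form_prod (b - c *+ k) s = form_prod b s - y *+ k.
  have addE b1 b2 : form_prod (b1 - b2) s = form_prod b1 s - form_prod b2 s.
    rewrite !aE -sumrB; apply: eq_bigr => i _.
    have cb : GRing.comm (chern b1) (chern b2) by apply: (constant_chern b1).1.
    by rewrite (chernB p_pr) (frobeniusXB_comm p_pr Hp i cb) mulrBr.
  elim: k => [|k IHk]; first by rewrite !subr0.
  by rewrite !mulrSr !opprD !addrA addE IHk.
exists N.+1, (fun i => (if i is j.+1 then a j ^+ p else 0)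
                       - (if (i < N)%N then y ^+ p.-1 * a i else 0)).
split=> [i|b].
  apply: constantB; first by case: i => [|i]; [exact: constant0 | exact: constantX].
  case: ifP => _; last exact: constant0.
  by apply: constantM => //; apply/constantX/constant_form_prod.
rewrite form_prod_cons; under eq_bigr do rewrite EB.
rewrite (prod_Fp p_pr Hp (comm b c)).
under [RHS]eq_bigr do rewrite mulrBl.
rewrite sumrB; congr (_ - _); last first.
  rewrite big_ord_recr /= ltnn mul0r addr0 (aE b) mulr_sumr; apply: eq_bigr => i _.
  by rewrite ltn_ord mulrA.
rewrite big_ord_recl mul0r add0r (aE b).
elim: N {aE EB comm y} => [|N IHN].
  by rewrite !big_ord0 expr0n -[p]prednK ?prime_gt0.
rewrite !big_ord_recr /= -IHN (frobenius_comm p_pr Hp).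
  rewrite [X in _ + X]exprMn_comm; last exact: (aC N).1.
  by rewrite -exprM -expnSr.
have cM : steenrod_constant (a N * chern b ^+ (p ^ N)).
  by apply: constantM => //; apply/constantX/constant_chern.
by apply: commr_sym; apply: cM.1.
Qed.

Lemma form_prod0 s : form_prod 0 s = 0.
Proof.
have [N [a [_ ->]]] := form_prodE s; rewrite big1 // => i _.
by rewrite chern0 // expr0n expn_eq0 -leqn0 leqNgt prime_gt0 // mulr0.
Qed.

Lemma form_prod_mem b s : b \in s -> form_prod b s = 0.
Proof.
have prod0 (ks : seq 'F_p) (f : 'F_p -> cohomology 'F_p G) k :
    k \in ks -> f k = 0 -> \prod_(j <- ks) f j = 0.
  elim: ks => //= j ks IHks; rewrite inE big_cons => /orP[/eqP<- ->|kks fk].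
    by rewrite mul0r.
  by rewrite IHks ?mulr0.
elim: s b => //= c s IHs b; rewrite inE form_prod_cons => /orP[/eqP->|/IHs bs].
  apply: (prod0 _ _ 1); first exact: mem_index_enum.
  have -> : nat_of_ord (1 : 'F_p) = 1%N by rewrite (val_Fp_nat p_pr 1) modn_small ?prime_gt1.
  by rewrite subrr form_prod0.
by apply: (prod0 _ _ 0); rewrite ?mem_index_enum // subr0.
Qed.

End AdditiveForms.

Section Divisibility.
Import GRing.Theory.
Local Open Scope ring_scope.
Variables (p : nat) (p_pr : prime p) (n : nat) (G : finGroupType).
Hypotheses (eG : elemab p G) (cG : #|G| = (p ^ n)%N).
Implicit Types (d : dual p G) (s : seq (dual p G)) (y z : cohomology 'F_p G).

Definition chern_prod s := \prod_(d <- s) chern d.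

Lemma chern_prod_cons d s : chern_prod (d :: s) = chern d * chern_prod s.
Proof. exact: big_cons. Qed.

Lemma chern_prod_coprime d s y z : d != 0 -> (forall d', d' \in s -> nonprop d d') ->
  chern_prod s * y = chern d * z -> exists y', y = chern d * y'.
Proof.
move=> d0; elim: s z => [|d' s IHs] z ds.
  by rewrite /chern_prod big_nil mul1r => ->; exists z.
rewrite chern_prod_cons -mulrA => E.
have dd' := nonpropP p_pr (ds d' (mem_head _ _)).
have [z' /IHs] := chern_coprime p_pr eG d0 dd' E; apply=> d'' d''s.
by apply: ds; rewrite inE d''s orbT.
Qed.

Lemma chern_prod_dvd s y :
  pairwise (@nonprop p G) s -> (forall d, d \in s -> d != 0 /\ exists z, y = chern d * z) ->
  exists z, y = chern_prod s * z.
Proof.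
elim: s => [|d s IHs] /=; first by exists y; rewrite /chern_prod big_nil mul1r.
move=> /andP[/allP ds ps] ys; have [|z yE] := IHs ps.
  by move=> d' d's; apply: ys; rewrite inE d's orbT.
have [d0 [z' yE']] := ys d (mem_head _ _).
have E : chern_prod s * z = chern d * z' by rewrite -yE.
have [z'' zE] := chern_prod_coprime d0 ds E.
exists z''; rewrite yE zE chern_prod_cons.
by rewrite mulrA -(chern_central p_pr eG cG d (chern_prod s)).
Qed.

Lemma chern_prod_regular s y : (forall d, d \in s -> d != 0) -> chern_prod s * y = 0 -> y = 0.
Proof.
elim: s => [|d s IHs] s0; first by rewrite /chern_prod big_nil mul1r.
rewrite chern_prod_cons -mulrA => E.
have {E} := chern_nonzero_regular p_pr eG (s0 d (mem_head _ _)) E.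
by apply: IHs => d' d's; apply: s0; rewrite inE d's orbT.
Qed.
End Divisibility.

Section StableIdeals.
Import GRing.Theory.
Local Open Scope ring_scope.
Variables (p : nat) (p_pr : prime p) (p_odd : odd p) (n : nat) (G : finGroupType).
Hypotheses (eG : elemab p G) (cG : #|G| = (p ^ n)%N).
Variable P : nat -> cohomology 'F_p G -> cohomology 'F_p G.
Hypothesis P_powers : reduced_powers P.
Implicit Types (b c d : dual p G) (s : seq (dual p G)) (u v w z : cohomology 'F_p G).
Implicit Types J : set (cohomology 'F_p G).

Lemma ideal_opp J u : two_sided_ideal J -> J u -> J (- u).
Proof. by case=> _ _ JM _ Ju; rewrite -mulN1r; apply: JM. Qed.

Lemma milnor_stable J i u :
  two_sided_ideal J -> steenrod_stable P J -> J u -> J (milnor P i u).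
Proof.
move=> Jid [Jb JP]; have [_ JD _ _] := Jid.
elim: i u => [|i IHi] u Ju /=; first exact: Jb.
by apply: JD; [apply/JP/IHi | apply/(ideal_opp Jid)/IHi/JP].
Qed.

Lemma Ess_stable : steenrod_stable P (Ess p G).
Proof.
split=> [u uE|m u uE]; first exact: (Ess_bockstein p_pr eG).
exact: (Ess_power p_pr eG P_powers).
Qed.

Let const := @steenrod_constant p G P.

(* [R] is a combination of Milnor operations. It kills the [cl b] with [b] in
   [s], since [form_prod b s] is then [0].                                     *)
Lemma derivation_exists s : exists R : cohomology 'F_p G -> cohomology 'F_p G,
  [/\ forall u v, R (u + v) = R u + R v,
      forall b u, R (cl b * u) = form_prod b s * u - cl b * R u,
      forall z u, const z -> R (z * u) = z * R u
    & forall J, two_sided_ideal J -> steenrod_stable P J -> forall u, J u -> J (R u)].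
Proof.
have anti i := milnorP p_pr eG cG P_powers i.
have [N [a [aC aE]]] := form_prodE p_pr eG cG P_powers s.
exists (fun u => \sum_(i < N) a i * milnor P i u); split.
- move=> u v; rewrite -big_split; apply: eq_bigr => i _.
  by rewrite (antiderD (anti i)) mulrDr.
- move=> b u; rewrite aE mulr_suml mulr_sumr -sumrB; apply: eq_bigr => i _.
  rewrite (antider_cl (anti i)) mulrBr mulrA; congr (_ - _).
  by rewrite mulrA ((aC i).1 (cl b)) -mulrA.
- move=> z u [zC zm]; rewrite mulr_sumr; apply: eq_bigr => i _.
  by rewrite zm mulrA -(zC (a i)) -mulrA.
- move=> J Jid Jst u Ju; have [J0 JD JM _] := Jid.
  elim: (N) => [|m IHm]; first by rewrite big_ord0.
  by rewrite big_ord_recr; apply: (JD) => //; apply: (JM); apply: milnor_stable.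
Qed.

Lemma const_chern_prod s : const (chern_prod s).
Proof.
elim: s => [|d s IHs]; first by rewrite /chern_prod big_nil; apply: constant1.
rewrite chern_prod_cons; apply: constantM IHs; exact: (constant_chern p_pr eG cG P_powers).
Qed.

Variable J : set (cohomology 'F_p G).
Hypotheses (Jid : two_sided_ideal J) (Jst : steenrod_stable P J).
Hypothesis Jprod : forall s, size s = n -> J (prod_cl s).

Lemma prod_cl_Ess s f : independent s -> size s = n -> Ess p G f ->
  exists2 k, J k & prod_cl s * f = chern_prod (all_forms s) * k.
Proof.
move=> indep_s sz_s /(EssP p_pr eG) fE.
have prod_kill b : prod_cl s * cl b = 0.
  have <- : prod_cl (rcons s b) = prod_cl s * cl b.
    by rewrite /prod_cl -cats1 big_cat big_seq1.
  by apply: (prod_cl_eq0 p_pr p_odd eG cG); rewrite size_rcons sz_s.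
have dvd d : d \in all_forms s -> d != 0 /\ exists z, prod_cl s * f = chern d * z.
  move=> /(all_forms_neq0 indep_s) d0; split=> //.
  have [w [v ->]] := fE d d0; exists (prod_cl s * v).
  by rewrite mulrDr mulrA prod_kill mul0r add0r mulrA -(chern_central p_pr eG cG) -mulrA.
have [k kE] := chern_prod_dvd p_pr eG cG (all_forms_pairwise p_pr indep_s) dvd.
exists k => //; have [s' sz_s' ann] := annihilator_of_degree1 p_pr p_odd eG cG.
have [|h ->] := ann k; last by case: Jid => _ _ _; apply; apply: Jprod.
move=> b; apply: (chern_prod_regular p_pr eG (s := all_forms s)).
  by move=> d /dvd[].
rewrite mulrA (const_chern_prod _).1 -mulrA -kE mulrA -prod_cl_cons.
by rewrite (prod_cl_eq0 p_pr p_odd eG cG) ?mul0r //= sz_s.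
Qed.

Let sign k : cohomology 'F_p G := (-1) ^+ k.

Let const_sign k : const (sign k).
Proof.
apply: constantX; rewrite -sub0r; apply: (constantB p_pr eG cG P_powers).
  exact: (constant0 p_pr eG cG P_powers).
exact: constant1.
Qed.

Let sign_sqr k : sign k * sign k = 1.
Proof. by rewrite /sign -exprD addnn -mul2n exprM sqrrN !expr1n. Qed.

Lemma prod_cl_comm s c : prod_cl s * cl c = sign (size s) * (cl c * prod_cl s).
Proof.
elim: s => [|b s IHs]; first by rewrite /prod_cl big_nil /sign !mul1r mulr1.
rewrite !prod_cl_cons -mulrA IHs [cl b * (sign _ * _)]mulrA.
rewrite -((const_sign (size s)).1 (cl b)) -mulrA.
rewrite [cl b * (cl c * _)]mulrA cl_anticomm mulNr -mulrA /sign /= exprS mulN1r.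
by rewrite mulrN mulNr.
Qed.

(* Each element of [s] is traded for a factor of [chern_prod (all_forms s)] by
   means of [form_prod c s * g = R (cl c * g) + cl c * R g].                   *)
Lemma Ess_descent D T s f : const D -> const T ->
    (forall g, Ess p G g -> exists2 k, J k & T * (prod_cl s * g) = D * k) ->
  Ess p G f -> exists2 k, J k & T * (chern_prod (all_forms s) * f) = D * k.
Proof.
move=> DC; elim: s T f => [|c s IHs] T f TC H fE.
  by have := H f fE; rewrite /prod_cl /chern_prod !big_nil.
pose e := form_prod c s.
have eC : const e := constant_form_prod p_pr eG cG P_powers c s.
have -> : chern_prod (all_forms (c :: s)) = e * chern_prod (all_forms s).
  by rewrite eC.1 /chern_prod /= big_cat.
rewrite -(mulrA e) (mulrA T); apply: IHs fE; first exact: constantM.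
move=> g gE; have [R [RD Rcl RC Rst]] := derivation_exists s.
set X := prod_cl s; pose Y := prod_cl (c :: s).
have Rprod t v : {subset t <= s} -> R (prod_cl t * v) = sign (size t) * (prod_cl t * R v).
  elim: t => [|b t IHt] ts; first by rewrite /prod_cl big_nil /sign !mul1r.
  have bs : form_prod b s = 0.
    by apply: (form_prod_mem p_pr eG cG P_powers); apply: ts; rewrite mem_head.
  rewrite !prod_cl_cons -!mulrA Rcl bs mul0r sub0r IHt; last first.
    by move=> d dt; apply: ts; rewrite inE dt orbT.
  rewrite [cl b * (sign _ * _)]mulrA -((const_sign (size t)).1 (cl b)) -mulrA.
  by rewrite /sign /= exprS mulN1r mulNr.
have XR v : X * R v = sign (size s) * R (X * v).
  by rewrite (Rprod s v) // mulrA sign_sqr mul1r.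
have XY v : X * (cl c * v) = sign (size s) * (Y * v).
  by rewrite mulrA prod_cl_comm -mulrA /Y prod_cl_cons.
have [k1 Jk1 E1] := H g gE.
have [k2 Jk2 E2] := H (R g) (Rst _ (Ess_two_sided_ideal p G) Ess_stable _ gE).
have [_ JD JM _] := Jid.
exists (R k1 + sign (size s) * k2); first by apply: JD; [exact: Rst | exact: JM].
have -> : T * e * (X * g) = T * (X * (e * g)).
  by rewrite -mulrA; congr (T * _); rewrite mulrA eC.1 -mulrA.
have -> : e * g = R (cl c * g) + cl c * R g by rewrite Rcl subrK.
rewrite mulrDr XR !XY (RC _ _ (const_sign _)) mulrA sign_sqr mul1r mulrDr.
rewrite -(RC _ _ TC) E1 (RC _ _ DC) mulrDr; congr (_ + _).
rewrite [T * (sign _ * _)]mulrA -((const_sign (size s)).1 T) -mulrA E2.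
by rewrite [sign _ * (D * _)]mulrA ((const_sign (size s)).1 D) -mulrA.
Qed.

Lemma Ess_sub f : Ess p G f -> J f.
Proof.
move=> fE; have [s sz_s indep_s] := basis_exists p_pr eG cG.
have [||g gE|k Jk E] := @Ess_descent (chern_prod (all_forms s)) 1 s f _ _ _ fE.
- exact: const_chern_prod.
- exact: constant1.
- by rewrite mul1r; apply: prod_cl_Ess.
suff -> : f = k by [].
apply/eqP; rewrite -subr_eq0; apply/eqP.
apply: (chern_prod_regular p_pr eG (s := all_forms s)).
  by move=> d; apply: (all_forms_neq0 indep_s).
by rewrite mulrBr -E mul1r subrr.
Qed.

End StableIdeals.

Section ExteriorPower.
Import GRing.Theory.
Local Open Scope ring_scope.
Variables (p : nat) (p_pr : prime p) (p_odd : odd p) (n : nat) (G : finGroupType).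
Hypotheses (eG : elemab p G) (cG : #|G| = (p ^ n)%N).

Lemma prod_degree1 m (a : 'I_m -> cohomology 'F_p G) :
  (forall j, coh_degree 1 (a j)) -> exists2 s, size s = m & \prod_j a j = prod_cl s.
Proof.
elim: m a => [|m IHm] a a1; first by exists [::]; rewrite ?big_ord0 // /prod_cl big_nil.
have [s sz_s E] := IHm (fun j => a (lift ord0 j)) (fun j => a1 _).
have [b bE] := degree1_cl (a1 ord0).
by exists (b :: s); rewrite /= ?sz_s // big_ord_recl E bE prod_cl_cons.
Qed.

Lemma exterior_power_prod_cl s : size s = n -> exterior_power 'F_p G n (prod_cl s).
Proof.
move=> sz_s; exists 1%N, (fun _ j => cl (nth 0 s j)).
  by move=> _ j; apply: degree1_of_cl.
by rewrite big_ord1 /prod_cl (big_nth 0) sz_s big_mkord.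
Qed.

Lemma exterior_power_sub_Ess u : exterior_power 'F_p G n u -> Ess p G u.
Proof.
have [E0 ED _ _] := Ess_two_sided_ideal p G.
move=> [r [a a1 ->]]; elim: r a a1 => [|r IHr] a a1; first by rewrite big_ord0.
rewrite big_ord_recr; apply: ED; first exact: IHr.
have [s sz_s ->] := prod_degree1 (a1 ord_max).
move=> W ltWG; have [b b0 bW] := separating_char p_pr eG ltWG.
have [S] := splitting_exists p_pr eG b0; apply: (spl_restriction S) => //.
have cS := spl_card S; rewrite pull_prod_cl.
case: n cG sz_s cS => [|m] cGm sz_s cS.
  by case/eqP: b0; apply: char_trivial cGm.
apply: (prod_cl_eq0 p_pr p_odd (spl_elemab S) (n := m)); last by rewrite size_map sz_s.
by apply/eqP; rewrite -(eqn_pmul2l (prime_gt0 p_pr)) -cS cGm expnS.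
Qed.
End ExteriorPower.

Theorem theorem1p1 (p n : nat) (V : finGroupType)
    (P : nat -> cohomology 'F_p V -> cohomology 'F_p V)
    (p_prime : prime p) (p_odd : odd p)
    (V_abelem : (p.-abelem [set: V])%g) (V_rank : 'r([set: V])%g = n)
    (P_powers : reduced_powers P) :
  Ess p V = steenrod_closure P (exterior_power 'F_p V n).
Proof.
have eV : elemab p V by apply/elemabP.
have cV : #|V| = (p ^ n)%N.
  rewrite -cardsT -V_rank (rank_abelem V_abelem).
  exact: card_pgroup (abelem_pgroup V_abelem).
apply/seteqP; split=> u.
  move=> uE I [[Iid Ist] Isub].
  apply: (Ess_sub p_prime p_odd eV cV P_powers Iid Ist) uE => s sz_s.
  exact/Isub/exterior_power_prod_cl.
apply; split; last by move=> v; apply: (exterior_power_sub_Ess p_prime p_odd eV cV).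
split; [exact: Ess_two_sided_ideal | exact: (Ess_stable p_prime eV P_powers)].
Qed.
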